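(* Let $p>1$ be an integer and $q=1/p$. For every integer $n\ge 1$ let $$\beta_n = d_{2n-1}(p)\,p_{n,n-1}(p^{2n-1}),\qquad \alpha_n = d_{2n-1}(p)\left[q_{n,n-1}(p^{2n-1})+p_{n,n-1}(p^{2n-1})\sum_{k=1}^{2n-2}\frac{1}{p^k-1}\right].$$ Then $\alpha_n,\beta_n\in\mathbb{Z}$ and $\beta_n\zeta_q(1)-\alpha_n\neq 0$ for all $n\ge 1$. Furthermore $$\lim_{n\to\infty}\left|\beta_n\zeta_q(1)-\alpha_n\right|^{1/n^2}\le p^{-\frac{3(\pi^2-4)}{\pi^2}}<1.$$
   Context: $\zeta_q(1)=\sum_{n=1}^\infty \frac{q^n}{1-q^n}=\sum_{n=1}^\infty\frac{1}{p^n-1}$. $(a;q)_k=\prod_{i=0}^{k-1}(1-aq^i)$. $d_n(x)=\prod_{k=1}^n\Phi_k(x)$, where $\Phi_k$ is the $k$-th cyclotomic polynomial. For integers $0\le m\le n$, $p_{n,m}$ is the polynomial of degree at most $n+m$ (a multiple little $q$-Jacobi polynomial) uniquely determined by $p_{n,m}(0)=1$ and the orthogonality conditions $$\sum_{k=0}^\infty q^k p_{n,m}(q^k)\,q^{k\ell}=0\quad(\ell=0,1,\dots,n-1),\qquad \sum_{k=0}^\infty k\,q^k p_{n,m}(q^k)\,q^{k\ell}=0\quad(\ell=0,1,\dots,m-1).$$ Explicitly, $$p_{n,m}(x)=\sum_{k=0}^m\sum_{j=0}^n\frac{(qx)^{k+j}}{(q;q)_k(q;q)_j}\,\frac{1}{q^{kn}}\,\frac{(q^{n+1};q)_{j+k}}{(q;q)_{j+k}}\,\frac{(q^{n+m+1};q)_k}{(q;q)_k}\,(q^{-n};q)_j(q^{-m};q)_k.$$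 The polynomial $q_{n,m}$ is defined by $$q_{n,m}(z)=\sum_{\ell=0}^\infty\frac{p_{n,m}(z)-p_{n,m}(q^\ell)}{z-q^\ell}\,q^\ell .$$ An empty sum is $0$. *)

(* Defs.v *)
From HB Require Import structures.
From mathcomp Require Import all_boot all_order all_algebra cyclotomic.
From mathcomp Require Import all_classical all_reals all_analysis.

Set Implicit Arguments.
Unset Strict Implicit.
Unset Printing Implicit Defensive.

Import Order.TTheory GRing.Theory Num.Theory.
Import numFieldNormedType.Exports.

Local Open Scope classical_set_scope.
Local Open Scope ring_scope.

Definition zeta_q1 (R : realType) (q : R) : R := \big[+%R/0]_(1 <= n <oo) (q ^+ n / (1 - q ^+ n)).

Definition dcyc (n : nat) : {poly int} := \prod_(1 <= k < n.+1) 'Phi_k.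

(* The orthogonality conditions are stated as convergence of the partial sums
   to 0, so that no default value of a divergent series can interfere. *)
Definition is_little_qJacobi (R : realType) (q : R) (n m : nat)
    (P : {poly R}) : Prop :=
  [/\ (size P <= (n + m).+1)%N,
      P.[0] = 1,
      forall l, (l < n)%N ->
        series (fun k : nat => q ^+ k * P.[q ^+ k] * q ^+ (k * l)) @ \oo
          --> (0 : R)
    & forall l, (l < m)%N ->
        series (fun k : nat => k%:R * q ^+ k * P.[q ^+ k] * q ^+ (k * l)) @ \oo
          --> (0 : R)].

(* For 0 < q < 1 and m <= n exactly one polynomial satisfies the predicate, so
   the default value 0 of xget is then irrelevant. *)
Definition little_qJacobi (R : realType) (q : R) (n m : nat) : {poly R} :=
  xget 0 [set P | is_little_qJacobi q n m P].

(* The quotient is a genuine difference quotient as long as z is not a power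
   of q, in particular for |z| > 1, the only case used below. *)
Definition qassoc (R : realType) (q : R) (n m : nat) (z : R) : R :=
  \big[+%R/0]_(0 <= l <oo)
    (((little_qJacobi q n m).[z] - (little_qJacobi q n m).[q ^+ l])
      / (z - q ^+ l) * q ^+ l).

Definition dval (R : realType) (p n : nat) : R := ((dcyc n).[p%:Z])%:~R.

Definition beta_ (R : realType) (p n : nat) : R :=
  dval R p (2 * n - 1) * (little_qJacobi (p%:R^-1 : R) n (n - 1)).[p%:R ^+ (2 * n - 1)].

Definition alpha_ (R : realType) (p n : nat) : R :=
  dval R p (2 * n - 1) *
  (qassoc (p%:R^-1 : R) n (n - 1) (p%:R ^+ (2 * n - 1)) +
   (little_qJacobi (p%:R^-1 : R) n (n - 1)).[p%:R ^+ (2 * n - 1)] *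
   \sum_(1 <= k < (2 * n - 1)%N) (p%:R ^+ k - 1)^-1).

(* Main.v *)
(* With q = 1/p, N = n + m and P the multiple little q-Jacobi polynomial, the
   moment generating function of P is
     F(t) = sum_k q^k P(q^k) t^k = sum_i c_i / (1 - q^(i+1) t),
   where c_i are the coefficients of P.  The orthogonality conditions prescribe
   all N zeros of its numerator, so that
     F(t) = C prod_(l<n) (1 - p^l t) prod_(l<m) (1 - p^l t)
              / prod_(1<=i<=N+1) (1 - q^i t),
   and the c_i are explicit products of Gaussian binomials.  With z = p^N, the
   linear form is d_N(p) r where
     r = sum_l q^l P(q^l) / (z - q^l) = sum_(j>=n) z^(-j-1) F(q^j).
   All terms of the last series have the sign of C: hence r is nonzero, and its
   first term gives its size p^(-3n^2 + O(n)).  Integrality of alpha_n rests on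
   p^k - 1 dividing d_N(p) for k <= N and on the integrality of P(p^l) for
   1 <= l <= N, where P(p^l) is an integer multiple of a divided difference of an
   integer polynomial at the integers p, ..., p^(N+1).
   Finally prod_(k<=N) (p^k - 1) = prod_(e<=N) d_(N/e)(p) gives
   log_p d_N(p) ~ N^2 / (2 zeta(2)) = 3 N^2 / pi^2, whence the limit is exactly
   p^(-3 + 12/pi^2). *)

Require Import Defs.
From HB Require Import structures.
From mathcomp Require Import all_boot all_order all_algebra cyclotomic.
From mathcomp Require Import separable.
From mathcomp Require Import all_classical all_reals all_analysis.
From mathcomp Require Import ring lra zify.

Set Implicit Arguments.
Unset Strict Implicit.
Unset Printing Implicit Defensive.

Import Order.TTheory GRing.Theory Num.Theory.
Import numFieldNormedType.Exports.

Local Open Scope classical_set_scope.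
Local Open Scope ring_scope.

(** * The value of zeta(2) *)

Section Basel.
Context {R : realType}.
Implicit Types x y : R.

Lemma sin_le_id x : 0 < x < pi / 2 -> sin x <= x.
Proof.
move=> /andP[x0 xp].
have [|c _ E] := @MVT R sin cos 0 x x0.
  by apply: continuous_subspaceT => y; exact: continuous_sin.
have := cos_le1 c; move: E; rewrite sin0 !subr0 => -> c1.
by rewrite ger_pMl.
Qed.

Lemma id_le_tan x : 0 < x < pi / 2 -> x <= tan x.
Proof.
move=> /andP[x0 xp].
have cp y : 0 <= y <= x -> 0 < cos y.
  move=> /andP[y0 yx]; apply: cos_gt0_pihalf.
  by rewrite (le_lt_trans yx xp) (lt_le_trans _ y0)// oppr_lt0; have := pihalf_ge1 R; lra.
have [||c + E] := @MVT R tan (fun y => (cos y)^-2) 0 x x0.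
- move=> y; rewrite in_itv/= => /andP[y0 yx]; apply: is_derive_tan.
  by rewrite gt_eqF// cp// !ltW.
- apply: derivable_within_continuous => y; rewrite in_itv/= => yx.
  by apply: derivable_tan; rewrite gt_eqF// cp.
rewrite in_itv/= => /andP[c0 cx].
move: E; rewrite tan0 !subr0 => ->.
have cc : 0 < cos c by apply: cp; rewrite !ltW.
by rewrite ler_pMl// invf_ge1 ?exprn_gt0// expr_le1 ?cos_le1// ltW.
Qed.

(** Invert and square [sin x <= x <= tan x], using [1 / tan^2 = 1 / sin^2 - 1]. *)
Lemma inv_sqr_sin_bounds x : 0 < x < pi / 2 ->
  (sin x)^-2 - 1 <= x^-2 <= (sin x)^-2.
Proof.
move=> xI; have /andP[x0 xp] := xI.
have s0 : 0 < sin x by exact: sin_gt0_pihalf.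
have c0 : 0 < cos x.
  by apply: cos_gt0_pihalf; rewrite xp (lt_trans _ x0)// oppr_lt0; have := pihalf_ge1 R; lra.
have -> : (sin x)^-2 - 1 = (tan x)^-2.
  rewrite /tan expr_div_n invf_div cos2sin2.
  by rewrite mulrBl mul1r divff// expf_neq0// gt_eqF.
have t0 : 0 < tan x by rewrite divr_gt0.
have inv_le (a b : R) : 0 < a -> a <= b -> b ^- 2 <= a ^- 2.
  move=> a0 ab; have b0 := lt_le_trans a0 ab.
  by rewrite lef_pV2 ?posrE ?exprn_gt0// ler_pXn2r// nnegrE ltW.
by rewrite !inv_le// ?id_le_tan ?sin_le_id.
Qed.

(** For [k < 2^n] these are the odd multiples of [pi / 2^(n+2)] in [(0, pi/2)]; doubling [a n.+1 k]
    gives [a n k]. *)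
Let a n k : R := (k.*2.+1%:R * pi) / 2 ^+ n.+2.

Let a_itv n k : (k < 2 ^ n)%N -> 0 < a n k < pi / 2.
Proof.
move=> kn; rewrite /a; apply/andP; split.
  by rewrite divr_gt0 ?exprn_gt0// mulr_gt0 ?pi_gt0.
rewrite ltr_pdivrMr ?exprn_gt0// exprS mulrA divfK//.
rewrite mulrC ltr_pM2l ?pi_gt0// -natrX ltr_nat.
by rewrite expnS; move: kn; lia.
Qed.

Lemma inv_sqr_sin_dup y : sin y != 0 -> cos y != 0 ->
  (sin y)^-2 + (cos y)^-2 = 4 * (sin (y *+ 2))^-2.
Proof.
move=> s0 c0; rewrite sin_mulr2n.
have -> : (sin y)^-2 + (cos y)^-2 = (sin y * cos y)^-2 * (cos y ^+ 2 + sin y ^+ 2).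
  by field; rewrite s0 c0.
by rewrite cos2Dsin2; field; rewrite s0 c0.
Qed.

(** The angles of level [n+1] pair up as [y] and [pi/2 - y]. By the duplication formula each pair
    contributes four times the term at [2y], an angle of level [n]. *)
Lemma sum_inv_sqr_sin n : \sum_(0 <= k < 2 ^ n) (sin (a n k))^-2 = 2 * 4 ^+ n.
Proof.
elim: n => [|n IH].
  rewrite big_nat1 expr0 /a mul1r (_ : 2 ^+ 2 = 4 :> R); last by ring.
  have c0 : cos (pi / 4 : R) != 0.
    rewrite gt_eqF// cos_gt0_pihalf//; have := pi_gt0 R => h.
    by apply/andP; split; lra.
  have := tan_piquarter R; rewrite /tan => /(congr1 (fun z => z * cos (pi / 4))).
  rewrite divfK// mul1r => sc; rewrite sc.
  have := cos2Dsin2 (pi / 4 : R); rewrite sc.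
  move=> h; have -> : cos (pi / 4 : R) ^+ 2 = 2^-1 by lra.
  by rewrite invrK mulr1.
rewrite exprS mulrCA -IH expnS mul2n -addnn.
rewrite (big_cat_nat (leq0n _) (leq_addr _ _))/=.
rewrite -[X in _ + \sum_(X <= _ < _) _](add0n (2 ^ n)%N) big_addn addnK.
(* Reversing the upper half of the index range puts [pi/2 - a n.+1 k] opposite [a n.+1 k]. *)
rewrite [X in _ + X]big_nat_rev/= -big_split/= mulr_sumr.
apply: eq_big_nat => k /andP[_ kn]; rewrite add0n.
have -> : a n k = a n.+1 k *+ 2.
  by rewrite /a [in RHS]exprS; field.
have /andP[a0 ap] : 0 < a n.+1 k < pi / 2 by apply: a_itv; rewrite expnS; lia.
have -> : sin (a n.+1 (2 ^ n - k.+1 + 2 ^ n)) = cos (a n.+1 k).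
  have -> : a n.+1 (2 ^ n - k.+1 + 2 ^ n) = - (a n.+1 k - pi / 2).
    rewrite /a; have -> : (2 ^ n - k.+1 + 2 ^ n).*2.+1%:R = 2 ^+ n.+2 - k.*2.+1%:R :> R.
      rewrite -natrX -natrB; first by congr (_%:R); rewrite !expnS; lia.
      by rewrite !expnS; move: kn; set w := (2 ^ n)%N; lia.
    by rewrite !exprS; field; rewrite expf_neq0 ?pnatr_eq0.
  by rewrite sinN sinBpihalf opprK.
apply: inv_sqr_sin_dup; rewrite gt_eqF//; first by apply: sin_gt0_pihalf; rewrite a0.
by apply: cos_gt0_pihalf; rewrite ap (lt_trans _ a0)// oppr_lt0; have := pihalf_ge1 R; lra.
Qed.

Let odd_sum n : R := \sum_(0 <= k < 2 ^ n) (k.*2.+1%:R ^- 2).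

(** Up to the factor [pi^2 / (16 * 4^n)] this is the sum of the [(a n k)^-2]. The [2^n] losses of
    [1] in the lower bound for [x^-2] become an error of order [2^-n] after scaling. *)
Let odd_sum_bounds n : pi ^+ 2 / 8 - pi ^+ 2 / 16 * 2^-1 ^+ n <= odd_sum n <= pi ^+ 2 / 8.
Proof.
have E : odd_sum n = (pi ^+ 2 / 16 * 4^-1 ^+ n) * \sum_(0 <= k < 2 ^ n) (a n k)^-2.
  rewrite /odd_sum mulr_sumr; apply: eq_bigr => k _; rewrite /a.
  have p0 : pi != 0 :> R by rewrite gt_eqF// pi_gt0.
  have -> : 4^-1 = 2^-1 ^+ 2 :> R by field.
  rewrite -exprM [(2 * n)%N]mulnC exprM exprVn !exprS; move: p0; move: (pi : R) => P p0; field.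
  by rewrite p0 expf_neq0 ?pnatr_eq0// addrC natr1 pnatr_eq0.
have c0 : 0 < pi ^+ 2 / 16 * 4^-1 ^+ n :> R.
  by rewrite mulr_gt0 ?exprn_gt0 ?divr_gt0 ?exprn_gt0 ?pi_gt0// invr_gt0.
have -> : pi ^+ 2 / 8 = (pi ^+ 2 / 16 * 4^-1 ^+ n) * (2 * 4 ^+ n) :> R.
  by rewrite exprVn; field; rewrite expf_neq0 ?pnatr_eq0.
have -> : pi ^+ 2 / 16 * 2^-1 ^+ n = (pi ^+ 2 / 16 * 4^-1 ^+ n) * 2 ^+ n :> R.
  have -> : 4^-1 = 2^-1 * 2^-1 :> R by field.
  by rewrite exprMn !exprVn; field; rewrite expf_neq0 ?pnatr_eq0.
rewrite -mulrBr E !ler_pM2l// -sum_inv_sqr_sin.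
apply/andP; split; last first.
  by apply: ler_sum_nat => k /andP[_ kn]; have /andP[] := inv_sqr_sin_bounds (a_itv kn).
have -> : 2 ^+ n = \sum_(0 <= k < 2 ^ n) 1 :> R by rewrite big_const_nat iter_addr addr0 subn0 natrX.
rewrite -sumrB.
by apply: ler_sum_nat => k /andP[_ kn]; have /andP[] := inv_sqr_sin_bounds (a_itv kn).
Qed.

Let S n : R := \sum_(0 <= k < n) (k.+1%:R ^- 2).

(** Separates odd from even denominators; in the limit it reads [L = pi^2/8 + L/4], which determines
    [L]. *)
Let S_dup n : S (2 ^ n.+1) = odd_sum n + S (2 ^ n) / 4.
Proof.
rewrite /S /odd_sum expnS mul2n; elim: (2 ^ n)%N => [|m IH].
  by rewrite !big_geq// mul0r addr0.
rewrite doubleS !big_nat_recr//= IH mulrDl.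
have -> : (m.*2.+2%:R : R) = m.+1%:R * 2 by rewrite -natrM; congr (_%:R); lia.
by field; rewrite !(addrC 1) !natr1 !pnatr_eq0.
Qed.

Let S_le n : S (2 ^ n) <= pi ^+ 2 / 6.
Proof.
elim: n => [|n IH].
  rewrite /S expn0 big_nat1 expr1n invr1 ler_pdivlMr// mul1r.
  have h := odd_sum_bounds 0; move: h.
  by rewrite /odd_sum expn0 big_nat1 expr1n invr1 => /andP[_]; rewrite ler_pdivlMr//; lra.
by rewrite S_dup; have /andP[_] := odd_sum_bounds n; move: IH; lra.
Qed.

Let S_nd : {homo S : n m / (n <= m)%N >-> n <= m}.
Proof.
move=> n m nm; rewrite /S (big_cat_nat (leq0n n) nm)/= lerDl.
by apply: sumr_ge0 => i _; rewrite invr_ge0 exprn_ge0.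
Qed.

Lemma basel_le n : \sum_(0 <= k < n) (k.+1%:R ^- 2) <= pi ^+ 2 / 6 :> R.
Proof. by apply: le_trans (S_le n); apply: S_nd; rewrite ltnW// ltn_expl. Qed.

Lemma basel : series (fun k => k.+1%:R ^- 2 : R) @ \oo --> (pi ^+ 2 / 6 : R).
Proof.
have Scvg : cvgn S.
  apply: nondecreasing_is_cvgn => //; exists (pi ^+ 2 / 6) => _ [n _ <-].
  exact: basel_le.
have pow_cvg : (fun n => S (2 ^ n)%N) @ \oo --> limn S.
  have : (fun n => 2 ^ n)%N @ \oo --> \oo.
    by apply/cvgnyPge => A; near=> n; rewrite (leq_trans _ (ltnW (ltn_expl n _)))//; near: n; exists A.
  by move=> /cvg_comp; apply.
have odd_cvg : odd_sum @ \oo --> (pi ^+ 2 / 8 : R).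
  apply: (@squeeze_cvgr _ _ _ _ (fun n => pi ^+ 2 / 8 - pi ^+ 2 / 16 * 2^-1 ^+ n) (fun=> pi ^+ 2 / 8)).
  - by near=> n; exact: odd_sum_bounds.
  - rewrite -[X in _ --> X]subr0; apply: cvgB; first exact: cvg_cst.
    apply: (@cvg_geometric R (pi ^+ 2 / 16) 2^-1).
    by rewrite ger0_norm// invf_lt1// ltr1n.
  - exact: cvg_cst.
suff <- : limn S = pi ^+ 2 / 6 by [].
have : (fun n => S (2 ^ n.+1)%N) @ \oo --> pi ^+ 2 / 8 + limn S / 4.
  under eq_cvg do rewrite S_dup.
  by apply: cvgD => //; apply: cvgMr_tmp.
have : (fun n => S (2 ^ n.+1)%N) @ \oo --> limn S by rewrite (cvg_shiftS (fun n => S (2 ^ n)%N)).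
move=> /cvg_unique H /H; move=> /(_ (@Rhausdorff _)).
lra.
Unshelve. all: by end_near. Qed.

(** Strictness makes the final exponent negative. Equality would force [cos 1 = 0]. *)
Lemma pi_gt2 : 2 < pi :> R.
Proof.
rewrite lt_neqAle pi_ge2 andbT; apply/eqP => E.
have := cos_pihalf R; rewrite -E divff// => c0.
by have := cos1_gt0 R; rewrite c0 ltxx.
Qed.

End Basel.

(** * A Tauberian theorem for divisor sums *)

Section Tauberian.
Context {R : realType}.
Implicit Types (D e : nat -> R) (A B b c : R).

Lemma divn_natr_bounds N k : (0 < k)%N ->
  N%:R / k%:R - 1 <= ((N %/ k)%:R : R) <= N%:R / k%:R.
Proof.
move=> k0; have k0R : 0 < k%:R :> R by rewrite ltr0n.
rewrite lerBlDr ler_pdivlMr// ler_pdivrMr// -natrM natr1 -natrM !ler_nat leq_trunc_div.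
by rewrite ltnW// ltn_ceil.
Qed.

(** Replacing [N / k] by its floor lowers the square by at most [2 N / k]. After division by [N^2]
    the total loss is twice the Cesaro mean of the harmonic sequence, which tends to 0. *)
Lemma sum_divn_sqr_cvg :
  (fun N => (\sum_(0 <= i < N) (N %/ i.+1)%:R ^+ 2) / N%:R ^+ 2) @ \oo
    --> (pi ^+ 2 / 6 : R).
Proof.
rewrite -(cvg_shiftS (fun N => (\sum_(0 <= i < N) (N %/ i.+1)%:R ^+ 2) / N%:R ^+ 2 : R)).
have S1 : (fun n => series (fun k => k.+1%:R ^- 2 : R) n.+1) @ \oo --> (pi ^+ 2 / 6 : R).
  by rewrite (cvg_shiftS (series (fun k => k.+1%:R ^- 2 : R))); exact: basel.
have H1 : (fun n => series (fun k => k.+1%:R ^- 2 : R) n.+1 - 2 * arithmetic_mean harmonic n)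
    @ \oo --> (pi ^+ 2 / 6 : R).
  rewrite -[X in _ --> X]subr0; apply: cvgB S1 _.
  rewrite -[X in _ --> X](mulr0 2).
  by apply: cvgMl_tmp; apply: cesaro; exact: cvg_harmonic.
apply: squeeze_cvgr H1 S1; near=> n.
have n0 : (0 : R) < n.+1%:R ^+ 2 by rewrite exprn_gt0.
rewrite /series /arithmetic_mean /=; set M := n.+1.
have M0 : M%:R != 0 :> R by rewrite pnatr_eq0.
rewrite ler_pdivlMr// ler_pdivrMr//; apply/andP; split.
  have -> : (\sum_(0 <= k < M) k.+1%:R ^- 2 -
      2 * (M%:R^-1 * \sum_(0 <= k < M) k.+1%:R^-1)) * M%:R ^+ 2 =
      \sum_(0 <= k < M) ((M%:R / k.+1%:R) ^+ 2 - 2 * (M%:R / k.+1%:R)) :> R.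
    rewrite sumrB -mulr_sumr -mulr_sumr.
    under [X in _ = X - _]eq_bigr do rewrite expr_div_n.
    by rewrite -mulr_sumr; field.
  apply: ler_sum_nat => i /andP[_ iM].
  have /andP[lo _] := divn_natr_bounds M (ltn0Sn i).
  have x1 : 1 <= M%:R / i.+1%:R :> R by rewrite ler_pdivlMr// mul1r ler_nat.
  move: lo x1; set x := M%:R / _; set y := _%:R => lo x1.
  (* This is [y^2 >= (x - 1)^2], and the right side is at least [x^2 - 2x]. *)
  have : 0 <= (y - (x - 1)) * (y + (x - 1)) by apply: mulr_ge0; lra.
  by rewrite expr2 expr2; nra.
rewrite mulr_suml; apply: ler_sum => i _.
have /andP[_ hi] := divn_natr_bounds M (ltn0Sn i).
by rewrite mulrC -expr_div_n ler_pXn2r// nnegrE ?divr_ge0.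
Unshelve. all: by end_near. Qed.

(** The first term [1/4] is kept exactly; the others telescope through [1/(i+1)^2 <= 1/i - 1/(i+1)]
    to at most [1/2]. *)
Lemma sum_inv_sqr_from2 n : \sum_(1 <= i < n) (i.+1%:R ^- 2) <= 3 / 4 :> R.
Proof.
case: n => [|[|n]]; [by rewrite big_geq//; lra..|].
rewrite big_ltn//.
have : \sum_(2 <= i < n.+2) (i.+1%:R ^- 2 : R) <= \sum_(2 <= i < n.+2) (- i.+1%:R^-1 - - i%:R^-1).
  apply: ler_sum_nat => i /andP[i2 _].
  have i0 : (0 : R) < i%:R by rewrite ltr0n; lia.
  rewrite -subr_ge0.
  have -> : - i.+1%:R^-1 - - i%:R^-1 - i.+1%:R ^- 2 = (i%:R * i.+1%:R ^+ 2)^-1 :> R.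
    have i1 : (0 : R) < i%:R + 1 by rewrite natr1.
    by rewrite -natr1; field; rewrite !gt_eqF.
  by rewrite invr_ge0 mulr_ge0// ?exprn_ge0// ltW.
rewrite telescope_sumr//.
have : 0 <= (n.+2%:R^-1 : R) by rewrite invr_ge0.
move=> h1 h2; have -> : (2 ^- 2 : R) = 1/4 by field.
move: h1 h2; move: (\sum_(2 <= i < n.+2) _) (n.+2%:R^-1) => x y; lra.
Qed.

(* Isolating the term [i = 0] of the divisor sum bounds [e N] by the others,
   and [sum_(k >= 2) 1/k^2 <= 3/4 < 1] makes this a contraction of the best
   constant in [|e N| <= b N^2]. *)
Lemma divisor_sum_contraction e B0 b :
  0 <= B0 -> 0 < b -> (forall N, (0 < N)%N -> `|e N| <= B0 * N%:R ^+ 2) ->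
  (fun N => (\sum_(0 <= i < N) e (N %/ i.+1)%N) / N%:R ^+ 2) @ \oo --> (0 : R) ->
  (\forall N \near \oo, `|e N| <= b * N%:R ^+ 2) ->
  (\forall N \near \oo, `|e N| <= 7 / 8 * b * N%:R ^+ 2).
Proof.
move=> B00 b0 eB r0 [M0 _ eb].
(* The quotients [N / (i+1)] may fall below the threshold [M0], so the eventual bound is extended to
   all arguments at the price of a constant. *)
have eU M : (0 < M)%N -> `|e M| <= b * M%:R ^+ 2 + B0 * M0%:R ^+ 2.
  move=> Mp; case: (leqP M0 M) => MM.
    apply: le_trans (eb _ MM) _; rewrite lerDl mulr_ge0// exprn_ge0//.
  apply: le_trans (eB _ Mp) _; apply: ler_wpDl.
    by rewrite mulr_ge0 ?exprn_ge0// ltW.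
  by rewrite ler_wpM2l// ler_pXn2r ?nnegrE// ler_nat ltnW.
near=> N.
have Np : (0 < N)%N by near: N; exact: nbhs_infty_gt.
have NR : (0 : R) < N%:R by rewrite ltr0n.
(* The factor [7/8] splits as [1/16] for the whole divisor sum, [3/4] for the terms [i >= 1], and
   [1/16] for the accumulated constants. *)
have rN : `|\sum_(0 <= i < N) e (N %/ i.+1)%N| <= b / 16 * N%:R ^+ 2.
  rewrite -ler_pdivrMr ?exprn_gt0//.
  have -> : `|\sum_(0 <= i < N) e (N %/ i.+1)%N| / N%:R ^+ 2 =
     `|0 - (\sum_(0 <= i < N) e (N %/ i.+1)%N) / N%:R ^+ 2|.
    by rewrite sub0r normrN normrM normfV (@ger0_norm _ (N%:R ^+ 2))// exprn_ge0.
  by near: N; apply: cvgr_dist_le r0 _ _; rewrite divr_gt0.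
have NB : B0 * M0%:R ^+ 2 <= b / 16 * N%:R.
  rewrite -ler_pdivrMl ?divr_gt0// ltW//.
  by near: N; exact: nbhs_infty_gtr.
move: rN; rewrite big_ltn// divn1.
set s := \sum_(1 <= i < N) _ => rN.
have sB : `|s| <= b * N%:R ^+ 2 * (3 / 4) + N%:R * (B0 * M0%:R ^+ 2).
  apply: le_trans (ler_norm_sum _ _ _) _.
  apply: (@le_trans _ _ (\sum_(1 <= i < N) (b * N%:R ^+ 2 * i.+1%:R ^- 2 + B0 * M0%:R ^+ 2))).
    apply: ler_sum_nat => i /andP[_ iN].
    apply: le_trans (eU _ _) _; first by rewrite divn_gt0.
    rewrite lerD2r -mulrA ler_pM2l// -expr_div_n ler_pXn2r ?nnegrE ?divr_ge0//.
    by have /andP[] := divn_natr_bounds N (ltn0Sn i).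
  rewrite big_split/= -mulr_sumr lerD//.
    by rewrite ler_wpM2l ?sum_inv_sqr_from2// mulr_ge0 ?exprn_ge0 ?ltW.
  rewrite big_const_nat iter_addr addr0 -[leLHS]mulr_natl ler_wpM2r ?mulr_ge0 ?exprn_ge0//.
  by rewrite ler_nat leq_subr.
have NB2 : N%:R * (B0 * M0%:R ^+ 2) <= b / 16 * N%:R ^+ 2.
  by rewrite (expr2 N%:R) [leRHS]mulrA [leLHS]mulrC ler_pM2r.
have := ler_normB (e N + s) s; rewrite addrK.
set x := N%:R ^+ 2 in rN sB NB2 *; lra.
Unshelve. all: by end_near. Qed.

(** For the error [e N = D N - c N^2] with [c = 6A / pi^2], the main terms of the divisor sum cancel
    by the value of [zeta(2)]. Nonnegativity of [D] gives a first bound [e = O(N^2)], and iterating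
    the contraction multiplies its constant by [(7/8)^j]. *)
Lemma divisor_sum_tauberian D A B :
  (forall n, 0 <= D n) ->
  (forall N, `|\sum_(0 <= i < N) D (N %/ i.+1)%N - A * N%:R ^+ 2| <= B * N%:R) ->
  (fun N => D N / N%:R ^+ 2) @ \oo --> 6 * A / pi ^+ 2.
Proof.
move=> D0 TD; set c := 6 * A / pi ^+ 2.
have pi0 : pi != 0 :> R by rewrite gt_eqF// pi_gt0.
have cA : A = c * (pi ^+ 2 / 6).
  by rewrite /c; move: pi0; move: (pi : R) => P P0; field.
clearbody c; pose e N := D N - c * N%:R ^+ 2.
have B0 : 0 <= B by have := TD 1%N; rewrite mulr1; apply: le_trans.
have eB N : (0 < N)%N -> `|e N| <= (`|A| + B + `|c|) * N%:R ^+ 2.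
  move=> Np; apply: (le_trans (ler_normB _ _)).
  rewrite [leRHS]mulrDl lerD//; last first.
    by rewrite normrM [X in _ * X]ger0_norm// exprn_ge0.
  rewrite ger0_norm//.
  apply: (@le_trans _ _ (\sum_(0 <= i < N) D (N %/ i.+1)%N)).
    by rewrite big_ltn// divn1 lerDl sumr_ge0.
  have := TD N; rewrite ler_norml => /andP[_]; rewrite lerBlDr => /le_trans; apply.
  rewrite [leRHS]mulrDl addrC lerD//; first by rewrite ler_wpM2r ?exprn_ge0// ler_norm.
  rewrite ler_wpM2l// expr2 ler_peMl// ler1n//.
have r0 : (fun N => (\sum_(0 <= i < N) e (N %/ i.+1)%N) / N%:R ^+ 2) @ \oo --> (0 : R).
  have -> : (fun N => (\sum_(0 <= i < N) e (N %/ i.+1)%N) / N%:R ^+ 2) =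
     (fun N => (\sum_(0 <= i < N) D (N %/ i.+1)%N) / N%:R ^+ 2
        - c * ((\sum_(0 <= i < N) (N %/ i.+1)%:R ^+ 2) / N%:R ^+ 2)).
    by apply/funext => N; rewrite /e sumrB -mulr_sumr mulrBl mulrA.
  rewrite [X in _ --> X](_ : 0 = A - c * (pi ^+ 2 / 6)); last by rewrite -cA subrr.
  apply: cvgB; last by apply: cvgMl_tmp; exact: sum_divn_sqr_cvg.
  rewrite -(cvg_shiftS (fun N => (\sum_(0 <= i < N) D (N %/ i.+1)%N) / N%:R ^+ 2 : R)).
  have h : (fun n => B * harmonic n) @ \oo --> (0 : R).
    by rewrite -[X in _ --> X](mulr0 B); apply: cvgMl_tmp; exact: cvg_harmonic.
  apply: (@squeeze_cvgr _ _ _ _ (fun n => A - B * harmonic n) (fun n => A + B * harmonic n)).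
  - near=> n; have n0 : (0 : R) < n.+1%:R ^+ 2 by rewrite exprn_gt0.
    have := TD n.+1; rewrite ler_norml /=.
    rewrite ler_pdivlMr// ler_pdivrMr//.
    rewrite mulrBl mulrDl.
    have -> : B * n.+1%:R^-1 * n.+1%:R ^+ 2 = B * n.+1%:R.
      by field; rewrite addrC natr1 pnatr_eq0.
    by set u := _ * n.+1%:R ^+ 2; move=> /andP[? ?]; apply/andP; split; lra.
  - by rewrite -[X in _ --> X]subr0; apply: cvgB => //; exact: cvg_cst.
  - by rewrite -[X in _ --> X]addr0; apply: cvgD => //; exact: cvg_cst.
pose b0 := `|A| + B + `|c| + 1.
have b00 : 0 < b0 by rewrite ltr_wpDl// !addr_ge0.
have eb j : \forall N \near \oo, `|e N| <= b0 * (7 / 8) ^+ j * N%:R ^+ 2.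
  elim: j => [|j IH].
    near=> N; rewrite mulr1; apply: le_trans (eB _ _) _.
      by near: N; exact: nbhs_infty_gt.
    by rewrite ler_wpM2r ?exprn_ge0// lerDl.
  rewrite exprS mulrCA.
  apply: divisor_sum_contraction eB r0 IH; first by rewrite !addr_ge0.
  by rewrite mulr_gt0// exprn_gt0.
apply/cvgrPdist_le => eps eps0.
have [j jeps] : exists j, b0 * (7 / 8) ^+ j <= eps.
  have : (fun j => b0 * (7 / 8 : R) ^+ j) @ \oo --> (0 : R).
    by apply: (@cvg_geometric R b0 (7 / 8)); rewrite ger0_norm//; lra.
  move=> /cvgr_dist_le /(_ eps eps0)[j _ /(_ j (leqnn j))]/=.
  by rewrite sub0r normrN => /(le_trans (ler_norm _)); exists j.
near=> N.
have Np : (0 < N)%N by near: N; exact: nbhs_infty_gt.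
have N0 : (0 : R) < N%:R ^+ 2 by rewrite exprn_gt0// ltr0n.
have : `|e N| <= eps * N%:R ^+ 2.
  apply: (@le_trans _ _ (b0 * (7 / 8) ^+ j * N%:R ^+ 2)); last by rewrite ler_pM2r.
  by near: N; exact: eb.
have -> : e N = - ((c - D N / N%:R ^+ 2) * N%:R ^+ 2).
  by rewrite /e mulrBl divfK ?gt_eqF// opprB.
by rewrite normrN normrM [X in _ * X]gtr0_norm// ler_pM2r.
Unshelve. all: by end_near. Qed.

End Tauberian.

(** * Values of cyclotomic polynomials *)

Lemma perm_divn_divisors n : (0 < n)%N ->
  perm_eq [seq (n %/ d)%N | d <- divisors n] (divisors n).
Proof.
move=> n0; have co d : (d %| n)%N -> (n %/ (n %/ d))%N = d.
  by move=> dn; rewrite divnA// mulKn.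
apply: uniq_perm; last 1 first.
- move=> d; rewrite -dvdn_divisors//; apply/mapP/idP => [[e]|dn].
    by rewrite -dvdn_divisors// => en ->; rewrite dvdn_div.
  by exists (n %/ d)%N; rewrite -?dvdn_divisors ?dvdn_div ?co.
- rewrite map_inj_in_uniq ?divisors_uniq// => d e; rewrite -!dvdn_divisors// => dn en.
  by move=> /(congr1 (fun x => n %/ x)%N); rewrite !co.
- exact: divisors_uniq.
Qed.

(** Both sides run over the pairs [d, i] with [d (i+1) <= N], weighted by [f d]. In the induction,
    passing to [N+1] raises the quotient by [i+1] exactly when [i+1] divides [N+1]. *)
Lemma sum_divisors_swap (V : nmodType) (f : nat -> V) N :
  \sum_(0 <= k < N) \sum_(d <- divisors k.+1) f d =
  \sum_(0 <= i < N) \sum_(0 <= j < N %/ i.+1) f j.+1.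
Proof.
elim: N => [|N IH]; first by rewrite !big_geq.
rewrite big_nat_recr//= IH.
transitivity (\sum_(0 <= i < N.+1) (\sum_(0 <= j < N %/ i.+1) f j.+1 +
   if (i.+1 %| N.+1)%N then f (N.+1 %/ i.+1)%N else 0)); last first.
  apply: eq_bigr => i _; rewrite divnS//; case: (i.+1 %| N.+1)%N; last by rewrite addr0.
  by rewrite add1n big_nat_recr.
rewrite big_split/= [in RHS]big_nat_recr//= [X in _ = _ + X + _]big_geq ?divn_small// addr0.
congr (_ + _); rewrite -(perm_big _ (perm_divn_divisors (ltn0Sn N)))/= big_map.
rewrite -big_mkcond/= -[in RHS](add0n N.+1).
rewrite -(big_add1 _ _ 0 N.+2 (fun i => i %| N.+1)%N (fun i => f (N.+1 %/ i)%N)).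
rewrite -[RHS]big_filter; apply: perm_big; apply: uniq_perm.
- exact: divisors_uniq.
- by rewrite filter_uniq// iota_uniq.
- move=> d; rewrite -dvdn_divisors// mem_filter mem_index_iota.
  case dN : (d %| N.+1)%N => //=; rewrite (dvdn_gt0 _ dN)//= ltnS.
  by rewrite dvdn_leq.
Qed.

Section CyclotomicValues.
Context {R : realType} (p : nat) (hp : (1 < p)%N).

Lemma prod_Cyclotomic_eval k : (0 < k)%N ->
  \prod_(d <- divisors k) ('Phi_d).[p%:Z] = p%:Z ^+ k - 1.
Proof.
move=> k0; rewrite -horner_prod prod_Cyclotomic//.
by rewrite !hornerE.
Qed.

(** Strong induction: [p^k - 1 > 0] is the product over the divisors of [k], and all factors but the
    last are already positive. *)
Lemma Cyclotomic_eval_gt0 k : (0 < k)%N -> 0 < ('Phi_k).[p%:Z].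
Proof.
elim/ltn_ind: k => k IH k0.
have := prod_Cyclotomic_eval k0.
rewrite (bigD1_seq k) ?divisors_uniq -?dvdn_divisors//=.
have P0 : 0 < \prod_(i <- divisors k | i != k) ('Phi_i).[p%:Z].
  rewrite big_seq_cond; apply: prodr_gt0 => d /andP[+ dk].
  rewrite -dvdn_divisors// => dvk; apply: IH; last exact: dvdn_gt0 dvk.
  by rewrite ltn_neqAle dk dvdn_leq.
have : 0 < p%:Z ^+ k - 1 by rewrite subr_gt0 exprn_egt1// -lt0n.
by move=> + E; rewrite -E pmulr_lgt0.
Qed.

Let phi k : R := (('Phi_k).[p%:Z])%:~R.

Lemma dvalE N : dval R p N = \prod_(0 <= j < N) phi j.+1.
Proof. by rewrite /dval /dcyc horner_prod rmorph_prod/= big_add1. Qed.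

Let phi_gt0 k : 0 < phi k.+1.
Proof. by rewrite /phi ltr0z Cyclotomic_eval_gt0. Qed.

Lemma dval_gt0 N : 0 < dval R p N.
Proof. by rewrite dvalE; apply: prodr_gt0 => j _. Qed.

Lemma prod_phi k : (0 < k)%N -> \prod_(d <- divisors k) phi d = p%:R ^+ k - 1.
Proof.
move=> k0; rewrite -rmorph_prod prod_Cyclotomic_eval//.
by rewrite rmorphB/= rmorphXn/= -pmulrn.
Qed.

(** The cyclotomic factors of [p^k - 1] are indexed by divisors of [k], all at most [N]; the
    quotient collects the remaining indices. *)
Lemma dval_div_int N k : (0 < k <= N)%N ->
  dval R p N / (p%:R ^+ k - 1) \is a Num.int.
Proof.
move=> /andP[k0 kN].
suff [S ->] : exists S : int, dval R p N = (p%:R ^+ k - 1) * S%:~R.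
  rewrite mulrAC divff ?mul1r ?intr_int//.
  by rewrite gt_eqF// subr_gt0 exprn_egt1 ?ltr1n// -lt0n.
exists (\prod_(0 <= j < N | ~~ (j.+1 %| k)%N) ('Phi_j.+1).[p%:Z]).
rewrite dvalE (bigID (fun j => j.+1 %| k)%N)/= rmorph_prod; congr (_ * _).
rewrite -prod_phi// -[in LHS](add0n N).
rewrite -(big_add1 _ _ 0 N.+1 (fun i => i %| k)%N phi).
rewrite -big_filter; apply: perm_big; apply: uniq_perm.
- by rewrite filter_uniq// iota_uniq.
- exact: divisors_uniq.
- move=> d; rewrite -dvdn_divisors// mem_filter mem_index_iota.
  case dN : (d %| k)%N => //=; rewrite (dvdn_gt0 _ dN)//= ltnS.
  by rewrite (leq_trans _ kN)// dvdn_leq.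
Qed.

Lemma ln_dvalE N : ln (dval R p N) = \sum_(0 <= j < N) ln (phi j.+1).
Proof.
rewrite dvalE; elim: N => [|N IH]; first by rewrite !big_geq// ln1.
rewrite !big_nat_recr//= lnM ?posrE ?IH//.
by apply: prodr_gt0 => j _.
Qed.

Lemma sum_ln_dval N :
  \sum_(0 <= i < N) ln (dval R p (N %/ i.+1)) = \sum_(0 <= k < N) ln (p%:R ^+ k.+1 - 1) :> R.
Proof.
under eq_bigr do rewrite ln_dvalE.
rewrite -(sum_divisors_swap (fun j => ln (phi j))); apply: eq_bigr => k _.
rewrite -prod_phi//.
have : all (fun d => 0 < d)%N (divisors k.+1).
  by apply/allP => d; rewrite -dvdn_divisors// => /dvdn_gt0; apply.
elim: (divisors _) => [|d s IH] /=; first by rewrite !big_nil ln1.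
move=> /andP[d0 s0]; rewrite !big_cons lnM ?posrE ?IH//.
  by case: d d0.
rewrite big_seq; apply: prodr_gt0 => i /(allP s0).
by case: i.
Qed.

Lemma ln_expr_sub1_bounds k : (0 < k)%N ->
  ln (p%:R : R) *+ k - ln 2 <= ln ((p%:R : R) ^+ k - 1) <= ln (p%:R : R) *+ k.
Proof.
move=> k0; have p0 : 0 < p%:R :> R by rewrite ltr0n ltnW.
have pk : 2 <= p%:R ^+ k :> R.
  by rewrite -natrX ler_nat (leq_trans hp)// -{1}(expn1 p) leq_exp2l.
rewrite -lnXn// -ln_div ?posrE ?exprn_gt0//.
move: pk; move: (_ ^+ k) => P P2.
by apply/andP; split; rewrite ler_ln ?posrE; lra.
Qed.

Lemma ln_dval_cvg :
  (fun N => ln (dval R p N) / N%:R ^+ 2) @ \oo --> 3 * ln p%:R / (pi : R) ^+ 2.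
Proof.
have -> : 3 * ln p%:R = 6 * (ln p%:R / 2) :> R by field.
(* The linear error covers [ln p / 2] per unit of [N] from the triangular sum of the [k ln p], and
   [ln 2] per term from replacing [p^k - 1] by [p^k]. *)
apply: (@divisor_sum_tauberian _ _ _ (ln p%:R + ln 2)).
  move=> N; rewrite ln_dvalE; apply: sumr_ge0 => j _; apply: ln_ge0.
  by rewrite /phi ler1z -gtz0_ge1 Cyclotomic_eval_gt0.
have lp : 0 <= ln p%:R :> R by rewrite ln_ge0// ler1n ltnW.
have l2 : 0 <= ln 2 :> R by rewrite ln_ge0// ler1n.
move=> N; rewrite sum_ln_dval.
have sE : \sum_(0 <= k < N) (ln (p%:R : R) *+ k.+1) = ln p%:R / 2 * N%:R ^+ 2 + ln p%:R / 2 * N%:R.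
  elim: N => [|N IH]; first by rewrite big_geq// expr0n !mulr0 addr0.
  by rewrite big_nat_recr//= IH -(mulr_natr _ N.+1) -natr1; field.
have lo : \sum_(0 <= k < N) (ln (p%:R : R) *+ k.+1 - ln 2) <= \sum_(0 <= k < N) ln (p%:R ^+ k.+1 - 1).
  by apply: ler_sum => k _; have /andP[] := ln_expr_sub1_bounds (ltn0Sn k).
have hi : \sum_(0 <= k < N) ln (p%:R ^+ k.+1 - 1) <= \sum_(0 <= k < N) (ln (p%:R : R) *+ k.+1).
  by apply: ler_sum => k _; have /andP[] := ln_expr_sub1_bounds (ltn0Sn k).
move: lo hi; rewrite sumrB sE big_const_nat iter_addr addr0 subn0 -[ln 2 *+ N]mulr_natr.
have N0 : 0 <= N%:R :> R by [].
set s := \sum_(0 <= k < N) _; set x := N%:R ^+ 2; move=> lo hi.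
have a1 : 0 <= ln p%:R * N%:R :> R by rewrite mulr_ge0.
have a2 : 0 <= ln 2 * N%:R :> R by rewrite mulr_ge0.
by rewrite ler_norml; apply/andP; split; lra.
Qed.

End CyclotomicValues.

(** * Sums of simple fractions *)

Lemma size_prod_1subZX (F : fieldType) (I : finType) (P : pred I) (a : I -> F) :
  (size (\prod_(i | P i) (1 - a i *: 'X))%R <= #|P|.+1)%N.
Proof.
apply: leq_trans (size_prod_leq _ _) _.
apply: (@leq_trans ((\sum_(i | P i) 2).+1 - #|P|)%N).
  apply: leq_sub2r; rewrite ltnS; apply: leq_sum => i _.
  rewrite (leq_trans (size_polyD _ _))// size_poly1 size_polyN.
  by rewrite geq_max/= (leq_trans (size_scale_leq _ _))// size_polyX.
by rewrite sum_nat_const muln2 -addnn; lia.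
Qed.

Section SimpleFractions.
Context {F : fieldType} (k : nat) (y : nat -> F).
Hypotheses (y0 : forall i, y i != 0) (y_inj : injective y).

Let lin i : {poly F} := 1 - y i *: 'X.
Definition den_except (i : 'I_k) : {poly F} := \prod_(j < k | j != i) lin j.
Definition den_all : {poly F} := \prod_(j < k) lin j.
(** For [y i = q^(i+1)], [numer P / den_all] is the moment generating function of [P]. *)
Definition numer (P : {poly F}) : {poly F} := \sum_(i < k) P`_i *: den_except i.

Let horner_lin i t : (lin i).[t] = 1 - y i * t.
Proof. by rewrite /lin !hornerE. Qed.

Lemma den_allE (i : 'I_k) : den_all = lin i * den_except i.
Proof. by rewrite /den_all (bigD1 i). Qed.

Lemma horner_den_except i t : (den_except i).[t] = \prod_(j < k | j != i) (1 - y j * t).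
Proof. by rewrite horner_prod; apply: eq_bigr => j _; rewrite horner_lin. Qed.

Lemma horner_den_all t : den_all.[t] = \prod_(j < k) (1 - y j * t).
Proof. by rewrite horner_prod; apply: eq_bigr => j _; rewrite horner_lin. Qed.

Lemma size_numer P : (size (numer P) <= k)%N.
Proof.
rewrite (leq_trans (size_sum _ _ _))//; apply/bigmax_leqP => i _.
rewrite (leq_trans (size_scale_leq _ _))// (leq_trans (size_prod_1subZX _ _))//.
by rewrite cardC1 card_ord prednK// (leq_ltn_trans _ (ltn_ord i)).
Qed.

Lemma den_except_node_neq0 i : (den_except i).[(y i)^-1] != 0.
Proof.
rewrite horner_den_except; apply/prodf_neq0 => j ji.
rewrite subr_eq0 eq_sym; apply: contra ji => /eqP/(congr1 (fun z => z * y i)).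
by rewrite mulfVK// mul1r => /y_inj/val_inj ->.
Qed.

Lemma numer_node P (i : 'I_k) : (numer P).[(y i)^-1] = P`_i * (den_except i).[(y i)^-1].
Proof.
rewrite horner_sum (bigD1 i)//= hornerZ big1 ?addr0// => j ji.
rewrite hornerZ horner_den_except (bigD1 i) 1?eq_sym//=.
by rewrite mulfV// subrr mul0r mulr0.
Qed.

(** Two polynomials of size at most [k] that agree at the [k] distinct poles [1 / y i]. *)
Lemma numer_unique (P G : {poly F}) : (size G <= k)%N ->
  (forall i : 'I_k, G.[(y i)^-1] = P`_i * (den_except i).[(y i)^-1]) -> numer P = G.
Proof.
move=> sG GE; apply/eqP; rewrite -subr_eq0; apply/eqP.
apply: (@roots_geq_poly_eq0 _ _ [seq (y i)^-1 | i <- iota 0 k]).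
- apply/allP => _ /mapP[i + ->]; rewrite mem_iota add0n => ik.
  by rewrite rootE !hornerE (numer_node _ (Ordinal ik)) (GE (Ordinal ik)) subrr.
- by rewrite map_inj_uniq ?iota_uniq// => i j /invr_inj /y_inj.
- rewrite size_map size_iota (leq_trans (size_polyD _ _))// size_polyN.
  by rewrite geq_max size_numer sG.
Qed.

Lemma numer_frac (P : {poly F}) t : den_all.[t] != 0 ->
  \sum_(i < k) P`_i / (1 - y i * t) = (numer P).[t] / den_all.[t].
Proof.
move=> d0; rewrite horner_sum mulr_suml; apply: eq_bigr => i _.
move: d0; rewrite (den_allE i) hornerM hornerZ horner_lin mulf_eq0 negb_or => /andP[l0 d0].
by field; rewrite d0.
Qed.

(** The quotient rule for the sum of simple fractions, multiplied by the squared denominator. *)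
Lemma numer_deriv (P : {poly F}) t : den_all.[t] != 0 ->
  (numer P)^`().[t] * den_all.[t] - (numer P).[t] * den_all^`().[t] =
  den_all.[t] ^+ 2 * \sum_(i < k) P`_i * y i / (1 - y i * t) ^+ 2.
Proof.
move=> d0; rewrite /numer raddf_sum/= !horner_sum !mulr_suml -sumrB mulr_sumr.
apply: eq_bigr => i _; rewrite derivZ !hornerZ.
move: d0; rewrite (den_allE i) derivM hornerD !hornerM horner_lin.
rewrite mulf_eq0 negb_or => /andP[l0 d0].
have -> : (lin i)^`().[t] = - y i by rewrite /lin !poly.derivE !hornerE/=; ring.
by field; rewrite l0.
Qed.

End SimpleFractions.

(** * Orthogonality conditions and zeros of the generating function *)

Section Orthogonality.
Context {R : realType}.

(** The closed form [E] of the partial sums bounds them, so this nonnegative series converges and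
    [k x^k] tends to 0; that in turn gives the limit of [E]. *)
Lemma cvg_series_nat_geometric (x : R) : 0 <= x < 1 ->
  series (fun k => k%:R * x ^+ k) @ \oo --> x / (1 - x) ^+ 2.
Proof.
move=> /andP[x0 x1]; have x10 : 0 < 1 - x by rewrite subr_gt0.
have E K : series (fun k => k%:R * x ^+ k) K =
    (x - (1 - x) * (K%:R * x ^+ K) - x * x ^+ K) / (1 - x) ^+ 2.
  rewrite /series /=; elim: K => [|K IH].
    by rewrite big_geq// mul0r mulr0 subr0 expr0 mulr1 subrr mul0r.
  by rewrite big_nat_recr//= IH (exprS x) -natr1; field; rewrite gt_eqF.
have t0 : (fun k => k%:R * x ^+ k) @ \oo --> 0.
  apply: cvg_series_cvg_0; apply: nondecreasing_is_cvgn.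
    move=> a b ab; rewrite /series /= (big_cat_nat (leq0n a) ab)/= lerDl.
    by apply: sumr_ge0 => i _; rewrite mulr_ge0// exprn_ge0.
  exists (x / (1 - x) ^+ 2) => _ [K _ <-]; rewrite E.
  rewrite ler_pM2r ?invr_gt0 ?exprn_gt0// -addrA -opprD gerBl addr_ge0//.
    by rewrite !mulr_ge0 ?exprn_ge0// ltW.
  by rewrite !mulr_ge0 ?exprn_ge0.
have -> : series (fun k => k%:R * x ^+ k) =
    (fun K => (x - (1 - x) * (K%:R * x ^+ K) - x * x ^+ K) / (1 - x) ^+ 2).
  by apply/funext.
apply: cvgMr_tmp; rewrite -[X in _ --> X]subr0 -[X in _ --> X - _]subr0.
apply: cvgB; [apply: cvgB; first exact: cvg_cst|].
  by rewrite -(mulr0 (1 - x)); apply: cvgMl_tmp.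
by rewrite -(mulr0 x); apply: cvgMl_tmp; apply: cvg_expr; rewrite ger0_norm.
Qed.

Lemma cvg_series_sum k (u : 'I_k -> R^nat) (l : 'I_k -> R) :
  (forall i, series (u i) @ \oo --> l i) ->
  series (fun j => \sum_(i < k) u i j) @ \oo --> \sum_(i < k) l i.
Proof.
move=> ul.
have -> : series (fun j => \sum_(i < k) u i j) = (fun K => \sum_(i < k) series (u i) K).
  by apply/funext => K; rewrite /series /= exchange_big.
by apply: cvg_big => //; exact: add_continuous.
Qed.

Context (q : R) (q0 : 0 < q) (q1 : q < 1).
Let y i := q ^+ i.+1.

Lemma qpow_mul_itv i t : 0 <= t <= 1 -> 0 <= q ^+ i.+1 * t < 1.
Proof.
move=> /andP[t0 t1]; apply/andP; split; first by rewrite mulr_ge0// exprn_ge0// ltW.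
apply: (@le_lt_trans _ _ (q ^+ i.+1)); first by rewrite ler_piMr// exprn_ge0// ltW.
by rewrite exprn_ilt1// ltW.
Qed.

Let termE k (P : {poly R}) t j : (size P <= k)%N ->
  q ^+ j * P.[q ^+ j] * t ^+ j = \sum_(i < k) P`_i * (y i * t) ^+ j.
Proof.
move=> sP; rewrite (horner_coef_wide _ sP) mulr_sumr mulr_suml.
apply: eq_bigr => i _; rewrite /y exprMn -!exprM (mulnC i.+1) mulnS exprD; ring.
Qed.

Lemma cvg_moment k (P : {poly R}) t : (size P <= k)%N -> 0 <= t <= 1 ->
  series (fun j => q ^+ j * P.[q ^+ j] * t ^+ j) @ \oo -->
    \sum_(i < k) P`_i / (1 - q ^+ i.+1 * t).
Proof.
move=> sP t01; under eq_fun do rewrite (termE _ _ sP).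
apply: cvg_series_sum => i.
have /andP[z0 z1] := qpow_mul_itv i t01.
by apply: (@cvg_geometric_series _ P`_i); rewrite ger0_norm.
Qed.

(** The weight [j] amounts to applying [t d/dt] to the moment generating function. *)
Lemma cvg_log_moment k (P : {poly R}) t : (size P <= k)%N -> 0 <= t <= 1 ->
  series (fun j => j%:R * q ^+ j * P.[q ^+ j] * t ^+ j) @ \oo -->
    t * \sum_(i < k) P`_i * q ^+ i.+1 / (1 - q ^+ i.+1 * t) ^+ 2.
Proof.
move=> sP t01.
have -> : (fun j => j%:R * q ^+ j * P.[q ^+ j] * t ^+ j) =
    (fun j => \sum_(i < k) P`_i * (j%:R * (y i * t) ^+ j)).
  apply/funext => j.
  rewrite (_ : _ * _ = j%:R * (q ^+ j * P.[q ^+ j] * t ^+ j)); last by ring.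
  rewrite (termE _ _ sP) mulr_sumr.
  by apply: eq_bigr => i _; ring.
rewrite mulr_sumr; apply: cvg_series_sum => i.
have -> : t * (P`_i * q ^+ i.+1 / (1 - q ^+ i.+1 * t) ^+ 2) =
    P`_i * (y i * t / (1 - y i * t) ^+ 2) by rewrite -/(y i); ring.
have -> : series (fun j => P`_i * (j%:R * (y i * t) ^+ j)) =
    (fun K => P`_i * series (fun j => j%:R * (y i * t) ^+ j) K).
  by apply/funext => K; rewrite /series /= mulr_sumr.
by apply: cvgMl_tmp; exact: cvg_series_nat_geometric (qpow_mul_itv i t01).
Qed.

Lemma den_all_gt0 k t : 0 <= t <= 1 -> 0 < (den_all k y).[t].
Proof.
move=> t01; rewrite horner_den_all; apply: prodr_gt0 => i _.
by have /andP[_] := qpow_mul_itv i t01; rewrite subr_gt0.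
Qed.

Let qpow_itv l : 0 <= q ^+ l <= 1.
Proof. by apply/andP; split; rewrite ?exprn_ge0// ?exprn_ile1// ltW. Qed.

Lemma moment_eq0P k (P : {poly R}) l : (size P <= k)%N ->
  (series (fun j => q ^+ j * P.[q ^+ j] * q ^+ (j * l)) @ \oo --> (0 : R)) <->
  (numer k y P).[q ^+ l] = 0.
Proof.
move=> sP; under eq_fun do rewrite mulnC exprM.
have C := cvg_moment sP (qpow_itv l); have d0 := den_all_gt0 k (qpow_itv l).
rewrite (numer_frac (y := y)) ?gt_eqF// in C.
split=> [C0|n0]; last by rewrite n0 mul0r in C.
have E : (numer k y P).[q ^+ l] / (den_all k y).[q ^+ l] = 0.
  by apply: cvg_unique C C0; exact: Rhausdorff.
by move/eqP: E; rewrite mulf_eq0 invr_eq0 (gt_eqF d0) orbF => /eqP.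
Qed.

(** At a zero of the numerator the quotient rule leaves only the derivative of the numerator over
    the denominator: the second family of conditions makes zeros double. *)
Lemma log_moment_eq0P k (P : {poly R}) l : (size P <= k)%N ->
  (numer k y P).[q ^+ l] = 0 ->
  (series (fun j => j%:R * q ^+ j * P.[q ^+ j] * q ^+ (j * l)) @ \oo --> (0 : R)) <->
  (numer k y P)^`().[q ^+ l] = 0.
Proof.
move=> sP n0; under eq_fun do rewrite mulnC exprM.
have C := cvg_log_moment sP (qpow_itv l); have d0 := den_all_gt0 k (qpow_itv l).
have ql0 : q ^+ l != 0 by rewrite expf_neq0// gt_eqF.
have := numer_deriv (y := y) P (negbT (gt_eqF d0)); rewrite n0 mul0r subr0.
move: C; set s := \sum_(_ < _) _ => C E.
have sE : s = 0 <-> (numer k y P)^`().[q ^+ l] = 0.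
  split=> h; move/eqP: E.
    by rewrite h mulr0 mulf_eq0 (gt_eqF d0) orbF => /eqP.
  by rewrite h mul0r eq_sym mulf_eq0 expf_eq0/= (gt_eqF d0) => /eqP.
rewrite -sE; split=> [C0|s0]; last by rewrite s0 mulr0 in C.
have E0 : q ^+ l * s = 0 by apply: cvg_unique C C0; exact: Rhausdorff.
by move/eqP: E0; rewrite mulf_eq0 (negbTE ql0) => /= /eqP.
Qed.

End Orthogonality.

(** * Existence and uniqueness of the little q-Jacobi polynomials *)

Lemma size_le_of_mul (F : idomainType) (A B : {poly F}) a b :
  size A = a.+1 -> (size (A * B)%R <= a + b)%N -> (size B <= b)%N.
Proof.
move=> sA; have [->|B0] := eqVneq B 0; first by rewrite size_poly0.
have A0 : A != 0 by rewrite -size_poly_eq0 sA.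
by rewrite size_mul// sA /=; lia.
Qed.

Section LittleJacobi.
Context {R : realType} (q : R) (q0 : 0 < q) (q1 : q < 1) (n m : nat) (mn : (m <= n)%N).
Local Notation N := (n + m)%N.
Let y i := q ^+ i.+1.

Let q_neq0 : q != 0. Proof. by rewrite gt_eqF. Qed.
Let y0 i : y i != 0. Proof. by rewrite expf_neq0. Qed.
Let qX_inj : injective (fun i => q ^+ i).
Proof. by move=> i j /(ieexprIn q0 _) /= h; apply: h; rewrite lt_eqF. Qed.
Let y_inj : injective y. Proof. by move=> i j /qX_inj []. Qed.

Definition jacobi_num : {poly R} :=
  \prod_(l < n) (1 - q ^- l *: 'X) * \prod_(l < m) (1 - q ^- l *: 'X).

Lemma size_jacobi_num : (size jacobi_num <= N.+1)%N.
Proof.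
apply: leq_trans (size_mul_leq _ _) _.
have S j : (size (\prod_(l < j) (1 - q ^- l *: 'X))%R <= j.+1)%N.
  rewrite -[X in (_ <= X.+1)%N]card_ord.
  exact: (size_prod_1subZX xpredT (fun l : 'I_j => q ^- l)).
by rewrite -subn1 leq_subLR add1n -addSn -addnS leq_add.
Qed.

Lemma horner_jacobi_num t : jacobi_num.[t] =
  (\prod_(l < n) (1 - q ^- l * t)) * \prod_(l < m) (1 - q ^- l * t).
Proof.
by rewrite hornerM !horner_prod; congr (_ * _); apply: eq_bigr => l _; rewrite !hornerE.
Qed.

Lemma jacobi_num_inv_neq0 i : jacobi_num.[q ^- i.+1] != 0.
Proof.
have H l : 1 - q ^- l * q ^- i.+1 != 0.
  rewrite -invfM -exprD subr_eq0 eq_sym -invr1 (inj_eq invr_inj).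
  by rewrite lt_eqF// exprn_ilt1 ?ltW// addnS.
by rewrite horner_jacobi_num mulf_neq0//; apply/prodf_neq0 => l _.
Qed.

Let k := N.+1.
(** The normalisation that makes the constant coefficient of [jacobi_poly] equal to 1. *)
Definition jacobi_const : R := (den_except (k := k) y ord0).[q^-1] / jacobi_num.[q^-1].

(** The coefficients are those of the partial fraction expansion of
    [jacobi_const * jacobi_num / den_all], read off at the poles [q^-(i+1)]. *)
Definition jacobi_poly : {poly R} :=
  \poly_(i < k) (jacobi_const * jacobi_num.[q ^- i.+1] / (den_except (k := k) y (inord i)).[q ^- i.+1]).

Lemma numer_jacobi_poly : numer k y jacobi_poly = jacobi_const *: jacobi_num.
Proof.
apply: (numer_unique y0 y_inj).
  by rewrite (leq_trans (size_scale_leq _ _))// size_jacobi_num.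
move=> i; rewrite coef_poly ltn_ord inord_val hornerZ divfK//.
exact: den_except_node_neq0.
Qed.

Lemma jacobi_poly0 : jacobi_poly.[0] = 1.
Proof.
rewrite horner_coef0 coef_poly /=; have -> : inord 0 = ord0 :> 'I_k.
  by apply: val_inj; rewrite /= inordK.
have d0 := den_except_node_neq0 y0 y_inj (ord0 : 'I_k).
have n0 := jacobi_num_inv_neq0 0.
rewrite /jacobi_const; move: d0 n0; rewrite /y /= !expr1 => d0 n0.
by field; rewrite d0 n0.
Qed.

Let root_num (l : 'I_n) : jacobi_num.[q ^+ l] = 0.
Proof.
by rewrite horner_jacobi_num (bigD1 l)//= mulVf ?expf_neq0// subrr !mul0r.
Qed.

Let deriv_num (l : 'I_m) : jacobi_num^`().[q ^+ l] = 0.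
Proof.
have P0 j (lj : (l < j)%N) : (\prod_(l < j) (1 - q ^- l *: 'X) : {poly R}).[q ^+ l] = 0.
  rewrite horner_prod (bigD1 (Ordinal lj))//= !hornerE mulVf ?expf_neq0//.
  by rewrite subrr mul0r.
rewrite /jacobi_num derivM hornerD !hornerM !P0 ?mulr0 ?mul0r ?addr0//.
exact: leq_trans mn.
Qed.

Lemma jacobi_poly_is_little : is_little_qJacobi q n m jacobi_poly.
Proof.
have sP : (size jacobi_poly <= k)%N by exact: size_poly.
have n0 l : (l < n)%N -> (numer k y jacobi_poly).[q ^+ l] = 0.
  by move=> ln; rewrite numer_jacobi_poly hornerZ (root_num (Ordinal ln)) mulr0.
split=> //; first exact: jacobi_poly0.
  by move=> l ln; apply/(moment_eq0P q0 q1 _ sP)/n0.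
move=> l lm; have ln := leq_trans lm mn.
apply/(log_moment_eq0P q0 q1 sP); first exact: n0.
by rewrite numer_jacobi_poly derivZ hornerZ (deriv_num (Ordinal lm)) mulr0.
Qed.

(* The numerator of the difference of two solutions has degree at most [N],
   simple zeros at the [q^l], double ones for [l < m], and one more at [1/q]
   because the constant coefficients agree: [N + 1] zeros in all. *)
Lemma little_qJacobi_unique P1 P2 :
  is_little_qJacobi q n m P1 -> is_little_qJacobi q n m P2 -> P1 = P2.
Proof.
move=> [s1 e1 a1 b1] [s2 e2 a2 b2].
pose G := numer k y P1 - numer k y P2.
have sG : (size G <= k)%N.
  by rewrite (leq_trans (size_polyD _ _))// size_polyN geq_max !size_numer.
have root_G l : (l < n)%N -> G.[q ^+ l] = 0.
  move=> ln; rewrite !hornerE.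
  by rewrite (moment_eq0P q0 q1 _ s1).1 ?(moment_eq0P q0 q1 _ s2).1 ?subrr//; auto.
have dG l : (l < m)%N -> G^`().[q ^+ l] = 0.
  move=> lm; have ln := leq_trans lm mn.
  have z1 := (moment_eq0P q0 q1 _ s1).1 (a1 _ ln).
  have z2 := (moment_eq0P q0 q1 _ s2).1 (a2 _ ln).
  rewrite derivB !hornerE.
  by rewrite ((log_moment_eq0P q0 q1 s1 z1).1 (b1 _ lm)) ((log_moment_eq0P q0 q1 s2 z2).1 (b2 _ lm)) subrr.
have G0 : G.[q^-1] = 0.
  have := numer_node y0 P1 (ord0 : 'I_k); have := numer_node y0 P2 (ord0 : 'I_k).
  rewrite /y /= expr1 -!horner_coef0 e1 e2 !mul1r.
  by rewrite !hornerE => -> ->; rewrite subrr.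
have [B GE] : exists B, G = B * \prod_(z <- [seq q ^+ l | l <- iota 0 n]) ('X - z%:P).
  apply/dvdpP; apply: uniq_roots_dvdp.
    apply/allP => _ /mapP[l + ->]; rewrite mem_iota add0n => ln.
    by rewrite rootE root_G.
  by rewrite uniq_rootsE map_inj_uniq ?iota_uniq.
set A := \prod_(z <- _) _ in GE.
have sA : size A = n.+1 by rewrite size_prod_XsubC size_map size_iota.
have sB : (size B <= m.+1)%N.
  by apply: size_le_of_mul sA _; rewrite mulrC -GE addnS.
have A0 l : (l < n)%N -> A.[q ^+ l] = 0.
  move=> ln; apply/rootP; rewrite root_prod_XsubC map_f// mem_iota add0n//.
have A1 : A.[q^-1] != 0.
  rewrite -rootE root_prod_XsubC; apply/negP => /mapP[l _ /eqP].
  by rewrite gt_eqF// (@le_lt_trans _ _ 1) ?exprn_ile1 ?invf_gt1 ?ltW.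
(* The roots of [A] are simple, so a double zero of [G = B A] at [q^l] is a zero of the cofactor
   [B]. *)
have dA l : (l < n)%N -> A^`().[q ^+ l] != 0.
  move=> ln; have : separable_poly A.
    by rewrite separable_prod_XsubC map_inj_uniq ?iota_uniq.
  by rewrite separable_poly.unlock => /coprimep_root; apply; apply/rootP; exact: A0.
have BE : B = 0.
  apply: (@roots_geq_poly_eq0 _ _ (q^-1 :: [seq q ^+ l | l <- iota 0 m])).
  - apply/andP; split.
      by move/eqP: G0; rewrite GE hornerM mulf_eq0 (negbTE A1) orbF.
    apply/allP => _ /mapP[l + ->]; rewrite mem_iota add0n => lm.
    have ln := leq_trans lm mn; have := dG _ lm.
    rewrite GE derivM hornerD !hornerM A0// mulr0 add0r => /eqP.
    by rewrite mulf_eq0 (negbTE (dA _ ln)) orbF.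
  - rewrite /= map_inj_uniq ?iota_uniq// andbT; apply/negP => /mapP[l _ /eqP].
    by rewrite gt_eqF// (@le_lt_trans _ _ 1) ?exprn_ile1 ?invf_gt1 ?ltW.
  - by rewrite /= size_map size_iota.
have nE : numer k y P1 = numer k y P2 by apply/eqP; rewrite -subr_eq0 -/G GE BE mul0r.
apply/polyP => i; have [ik|ki] := ltnP i k; last first.
  by rewrite !nth_default// (leq_trans _ ki).
have := numer_node y0 P1 (Ordinal ik); rewrite nE (numer_node y0 P2).
by move=> /(mulIf (den_except_node_neq0 y0 y_inj _)).
Qed.

Lemma little_qJacobiE : little_qJacobi q n m = jacobi_poly.
Proof.
apply: little_qJacobi_unique jacobi_poly_is_little.
by apply: (xgetPex 0); exists jacobi_poly; exact: jacobi_poly_is_little.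
Qed.

End LittleJacobi.

(** * The remainder *)

Section Remainder.
Context {R : realType} (q : R) (q0 : 0 < q) (q1 : q < 1).

Let q_neq0 : q != 0. Proof. by rewrite gt_eqF. Qed.
Let qX_ge0 l : 0 <= q ^+ l. Proof. by rewrite exprn_ge0// ltW. Qed.
Let qX_le1 l : q ^+ l <= 1. Proof. by rewrite exprn_ile1// ltW. Qed.

Lemma cvg_series_dominated (u : R^nat) K : (forall l, `|u l| <= K * q ^+ l) ->
  exists2 s : R, series u @ \oo --> s & `|s| <= K / (1 - q).
Proof.
move=> uK.
have K0 : 0 <= K by have := uK 0; rewrite mulr1; apply: le_trans.
have gc := @cvg_geometric_series R K q; have {}gc := gc ltac:(by rewrite ger0_norm// ltW).
have nc : cvgn [normed series u].
  apply: (@series_le_cvg _ _ (geometric K q)) => //.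
  - by move=> n; rewrite /= normr_ge0.
  - by move=> n; rewrite /= mulr_ge0// exprn_ge0// ltW.
  - by apply: cvgP gc.
exists (limn (series u)); first exact: normed_cvg.
apply: le_trans (lim_series_norm nc) _.
apply: limr_le => //; near=> L.
rewrite /series /=; apply: (@le_trans _ _ (\sum_(0 <= k < L) K * q ^+ k)).
  exact: ler_sum.
have := geometric_seriesE K (negbT (lt_eqF q1)) => /(congr1 (fun f => f L)).
rewrite /series /= => ->; rewrite ler_pM2r ?invr_gt0 ?subr_gt0//.
by rewrite ler_piMr// gerBl exprn_ge0// ltW.
Unshelve. all: by end_near. Qed.

Lemma horner_bounded (P : {poly R}) : exists2 M, 0 <= M & forall l, `|P.[q ^+ l]| <= M.
Proof.
exists (\sum_(i < size P) `|P`_i|); first by apply: sumr_ge0.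
move=> l; rewrite horner_coef (le_trans (ler_norm_sum _ _ _))//.
apply: ler_sum => i _; by rewrite normrM ler_piMr// -exprM ger0_norm.
Qed.

Context (n m : nat) (mn : (m <= n)%N) (n0 : (0 < n)%N).
Local Notation N := (n + m)%N.
Local Notation P := (jacobi_poly q n m).
Local Notation C := (jacobi_const q n m).
Let y i := q ^+ i.+1.
Let k := N.+1.
Let z := q ^- N.
Let F j := (jacobi_num q n m).[q ^+ j] / (den_all k y).[q ^+ j].

Let N0 : (0 < N)%N. Proof. by rewrite addn_gt0 n0. Qed.
Let zinv : z^-1 = q ^+ N. Proof. by rewrite invrK. Qed.
Let z_gt1 : 1 < z. Proof. by rewrite invf_gt1 ?exprn_gt0// exprn_ilt1 ?ltW// -lt0n. Qed.
Let z0 : 0 < z. Proof. exact: lt_trans z_gt1. Qed.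

Let zsub_gt0 l : 0 < z - q ^+ l.
Proof. by rewrite subr_gt0 (le_lt_trans _ z_gt1)// exprn_ile1 ?ltW. Qed.

Let qpow_itv l : 0 <= q ^+ l <= 1.
Proof. by rewrite qX_ge0 qX_le1. Qed.

Lemma cvg_jacobi_moment j :
  series (fun l => q ^+ l * P.[q ^+ l] * (q ^+ j) ^+ l) @ \oo --> C * F j.
Proof.
have sP : (size P <= k)%N by exact: size_poly.
have := cvg_moment q0 q1 sP (qpow_itv j).
have d0 : (den_all k y).[q ^+ j] != 0 by rewrite gt_eqF// den_all_gt0.
rewrite (numer_frac _ d0) numer_jacobi_poly//.
by rewrite hornerZ /F mulrA.
Qed.

Lemma jacobi_moment_eq0 j : (j < n)%N -> F j = 0.
Proof.
move=> jn; rewrite /F horner_jacobi_num (bigD1 (Ordinal jn))//=.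
by rewrite mulVf ?expf_neq0// subrr !mul0r.
Qed.

Let numj_itv j : (n <= j)%N ->
  (1 - q) ^+ N <= (jacobi_num q n m).[q ^+ j] <= 1.
Proof.
move=> nj; rewrite horner_jacobi_num exprD.
have B i (i_n : (i <= n)%N) : (1 - q) ^+ i <= \prod_(l < i) (1 - q ^- l * q ^+ j) <= 1.
  have I (l : 'I_i) : 1 - q <= 1 - q ^- l * q ^+ j <= 1.
    have lj : (l < j)%N by rewrite (leq_trans (ltn_ord l))// (leq_trans i_n).
    rewrite -(subnKC (ltnW lj)) exprD mulKf ?expf_neq0//.
    apply/andP; split; last by rewrite gerBl.
    by rewrite lerB// -[leRHS]expr1 ler_wiXn2l ?ltW// subn_gt0.
  apply/andP; split.
    rewrite -[X in _ ^+ X]card_ord -prodr_const; apply: ler_prod => l _.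
    by rewrite subr_ge0 ltW//; have /andP[] := I l.
  by apply: prodr_ile1 => l _; have /andP[h ->] := I l; rewrite (le_trans _ h)// subr_ge0 ltW.
have /andP[a1 a2] := B n (leqnn n); have /andP[b1 b2] := B m mn.
have q10 i : 0 <= (1 - q) ^+ i by rewrite exprn_ge0// subr_ge0 ltW.
apply/andP; split; first by rewrite ler_pM.
by rewrite mulr_ile1// (le_trans _ a1, le_trans _ b1).
Qed.

Let den_itv j : (1 - q) ^+ k <= (den_all k y).[q ^+ j] <= 1.
Proof.
rewrite horner_den_all.
have I (i : 'I_k) : 1 - q <= 1 - y i * q ^+ j <= 1.
  rewrite /y -exprD; apply/andP; split; last by rewrite gerBl.
  by rewrite lerB// -[leRHS]expr1 ler_wiXn2l ?ltW// addSn.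
apply/andP; split.
  rewrite -[X in _ ^+ X]card_ord -prodr_const; apply: ler_prod => l _.
  by rewrite subr_ge0 ltW//; have /andP[] := I l.
by apply: prodr_ile1 => l _; have /andP[h ->] := I l; rewrite (le_trans _ h)// subr_ge0 ltW.
Qed.

(** For [j >= n] each of the [N] numerator factors and [N + 1] denominator factors lies in
    [[1 - q, 1]]. The positivity rules out cancellation between moments. *)
Lemma jacobi_moment_itv j : (n <= j)%N -> (1 - q) ^+ N <= F j <= (1 - q) ^- N.+1.
Proof.
move=> nj; have /andP[a1 a2] := numj_itv nj; have /andP[b1 b2] := den_itv j.
have q10 i : 0 < (1 - q) ^+ i by rewrite exprn_gt0// subr_gt0.
have d0 := lt_le_trans (q10 _) b1.
rewrite /F ler_pdivlMr// ler_pdivrMr//; apply/andP; split.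
  by apply: le_trans a1; rewrite ler_piMr// ltW.
apply: le_trans a2 _; rewrite -ler_pdivrMl ?invr_gt0// invrK mulr1//.
Qed.

Definition rem_term l : R := q ^+ l * P.[q ^+ l] / (z - q ^+ l).

(* Expanding [1 / (z - q^l)] in powers of [1/z] turns the remainder into a
   series of moments, of which the first [n] vanish. *)
Lemma remainder_expansion : exists2 r : R, series rem_term @ \oo --> r &
  (fun J => C * \sum_(0 <= j < J) z ^- j.+1 * F j) @ \oo --> r.
Proof.
have [M M0 PM] := horner_bounded P.
have termB J l : `|rem_term l * (q ^+ J) ^+ l| <= M / (z - 1) * q ^+ l.
  rewrite !normrM normfV [`|z - _|]gtr0_norm//.
  rewrite -exprM ![`|q ^+ _|]ger0_norm//.
  apply: (@le_trans _ _ (q ^+ l * `|P.[q ^+ l]| / (z - q ^+ l))).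
    by rewrite ler_piMr//; apply: divr_ge0; [exact: mulr_ge0|exact: ltW].
  rewrite -mulrA [leRHS]mulrC ler_wpM2l//.
  apply: ler_pM => //; first by rewrite invr_ge0 ltW.
  have z1 : 0 < z - 1 by rewrite subr_gt0.
  by rewrite lef_pV2 ?posrE// lerB.
have [r rc _] : exists2 s : R, series rem_term @ \oo --> s & `|s| <= M / (z - 1) / (1 - q).
  apply: cvg_series_dominated => l; have := termB 0%N l.
  by rewrite expr0 expr1n mulr1.
exists r => //.
have main J : `|r - C * \sum_(0 <= j < J) z ^- j.+1 * F j| <= M / (z - 1) / (1 - q) * (q ^+ N) ^+ J.
  have [s sc sB] := cvg_series_dominated (termB J).
  suff -> : r - C * \sum_(0 <= j < J) z ^- j.+1 * F j = z ^- J * s.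
    rewrite normrM mulrC [`|_ ^- J|]ger0_norm; last by rewrite invr_ge0 exprn_ge0// ltW.
    by rewrite -exprVn zinv ler_wpM2r// exprn_ge0// exprn_ge0// ltW.
  apply/eqP; rewrite subr_eq; apply/eqP.
  apply: (cvg_unique _ rc); first exact: Rhausdorff.
  have -> : series rem_term = (fun L => z ^- J * series (fun l => rem_term l * (q ^+ J) ^+ l) L
      + \sum_(j < J) z ^- j.+1 * series (fun l => q ^+ l * P.[q ^+ l] * (q ^+ j) ^+ l) L).
    apply/funext => L; rewrite /series /= mulr_sumr.
    under [X in _ = _ + X]eq_bigr do rewrite mulr_sumr.
    rewrite exchange_big -big_split/=; apply: eq_bigr => l _.
    have zl := gt_eqF (zsub_gt0 l).
    have zn : z != 0 by rewrite gt_eqF.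
    have := subrXX z (q ^+ l) J => E.
    have -> : \sum_(i < J) z ^- i.+1 * (q ^+ l * P.[q ^+ l] * q ^+ i ^+ l) =
       q ^+ l * P.[q ^+ l] / z ^+ J * \sum_(i < J) z ^+ (J.-1 - i) * (q ^+ l) ^+ i.
      rewrite mulr_sumr; apply: eq_bigr => i _.
      have -> : z ^+ J = z ^+ (J.-1 - i) * z ^+ i.+1.
        by rewrite -exprD; congr (_ ^+ _); have := ltn_ord i; lia.
      by rewrite -!exprM (mulnC i); field; rewrite !expf_neq0.
    have -> : \sum_(i < J) z ^+ (J.-1 - i) * (q ^+ l) ^+ i = (z ^+ J - q ^+ l ^+ J) / (z - q ^+ l).
      by rewrite E mulrC mulKf// zl.
    by rewrite /rem_term -!exprM (mulnC J); field; rewrite expf_neq0//= zl.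
  have -> : z ^- J * s + C * \sum_(0 <= j < J) z ^- j.+1 * F j =
     z ^- J * s + \sum_(j < J) z ^- j.+1 * (C * F j).
    by rewrite big_mkord mulr_sumr; congr (_ + _); apply: eq_bigr => j _; ring.
  apply: cvgD; first by apply: cvgMl_tmp.
  apply: cvg_big => [|j _]; first exact: add_continuous.
  by apply: cvgMl_tmp; exact: cvg_jacobi_moment.
have g0 : (fun J => M / (z - 1) / (1 - q) * (q ^+ N) ^+ J) @ \oo --> (0 : R).
  apply: (@cvg_geometric R _ (q ^+ N)).
  by rewrite ger0_norm// exprn_ilt1 ?ltW// -lt0n.
apply/cvgrPdist_le => eps eps0; near=> J.
apply: le_trans (main J) _; apply: le_trans (ler_norm _) _; rewrite -normrN -sub0r.
by near: J; exact: cvgr_dist_le g0 _ eps0.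
Unshelve. all: by end_near. Qed.

(** The moments from index [n] on are positive, so the term [j = n] bounds the sum below. Above,
    [N (j+1) >= N (n+1) + (j - n)] gives a geometric majorant, which costs one more factor
    [1 / (1 - q)]. *)
Lemma remainder_bounds : exists2 r : R, series rem_term @ \oo --> r &
  `|C| * ((1 - q) ^+ N * q ^+ (N * n.+1)) <= `|r| <=
  `|C| * ((1 - q) ^- N.+2 * q ^+ (N * n.+1)).
Proof.
have [r rc rJ] := remainder_expansion; exists r => //.
have q10 : 0 < 1 - q by rewrite subr_gt0.
have zE i : z ^- i = q ^+ (N * i) by rewrite -exprVn zinv exprM.
have nJ : (fun J => `|C * \sum_(0 <= j < J) z ^- j.+1 * F j|) @ \oo --> `|r|.
  exact: cvg_norm rJ.
have nE J : (n < J)%N -> `|C * \sum_(0 <= j < J) z ^- j.+1 * F j| =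
    `|C| * \sum_(n <= j < J) z ^- j.+1 * F j.
  move=> nJlt; rewrite normrM (big_cat_nat (leq0n n) (ltnW nJlt))/= big_nat big1 ?add0r.
    congr (_ * _); rewrite ger0_norm// big_nat; apply: sumr_ge0 => j /andP[nj _].
    apply: mulr_ge0; first by rewrite zE.
    have /andP[+ _] := jacobi_moment_itv nj; apply: le_trans.
    by rewrite exprn_ge0// ltW.
  by move=> j /andP[_ jn]; rewrite jacobi_moment_eq0// mulr0.
have rE := cvg_lim (@Rhausdorff R) nJ.
have rcv := cvgP _ nJ.
rewrite -rE; apply/andP; split.
  apply: limr_ge => //; near=> J.
  have nJlt : (n < J)%N by near: J; exact: nbhs_infty_gt.
  rewrite nE// ler_wpM2l// big_ltn// -[leLHS]addr0 lerD//.
    rewrite mulrC zE ler_wpM2l//.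
    by have /andP[] := jacobi_moment_itv (leqnn n).
  rewrite big_nat; apply: sumr_ge0 => j /andP[nj _].
  apply: mulr_ge0; first by rewrite zE.
  have /andP[+ _] := jacobi_moment_itv (ltnW nj); apply: le_trans.
  by rewrite exprn_ge0// ltW.
apply: limr_le => //; near=> J.
have nJlt : (n < J)%N by near: J; exact: nbhs_infty_gt.
rewrite nE// ler_wpM2l//.
apply: (@le_trans _ _ (\sum_(n <= j < J) q ^+ (N * n.+1) * q ^+ (j - n) * (1 - q) ^- N.+1)).
  apply: ler_sum_nat => j /andP[nj _].
  have /andP[_ h] := jacobi_moment_itv nj.
  rewrite zE; apply: ler_pM => //.
    have /andP[+ _] := jacobi_moment_itv nj; apply: le_trans.
    by rewrite exprn_ge0// ltW.
  rewrite -exprD ler_wiXn2l ?ltW// -[in X in (_ <= X)%N](subnKC nj) -addSn mulnDr.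
  by rewrite leq_add2l leq_pmull.
rewrite -mulr_suml -mulr_sumr mulrAC [leRHS]mulrC -mulrA ler_wpM2l//.
rewrite [in leRHS]exprSr invfM; apply: ler_wpM2l; first by rewrite invr_ge0 exprn_ge0 ?ltW.
rewrite -{1}(add0n n) big_addn; under eq_bigr do rewrite addnK.
have := geometric_seriesE 1 (negbT (lt_eqF q1)) => /(congr1 (fun f => f (J - n)%N)).
rewrite /series /=; under eq_bigr do rewrite mul1r.
by move=> ->; rewrite mul1r ler_piMl ?invr_ge0 ?(ltW q10)// gerBl.
Unshelve. all: by end_near. Qed.

End Remainder.

(** * Closed forms for the constant, and the link between the remainder and [zeta_q1] *)

Section ClosedForms.
Context {R : realType} (q : R) (q0 : 0 < q) (q1 : q < 1).

Let q_neq0 : q != 0. Proof. by rewrite gt_eqF. Qed.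
Let qX_ge0 l : 0 <= q ^+ l. Proof. by rewrite exprn_ge0// ltW. Qed.
Let qX_le1 l : q ^+ l <= 1. Proof. by rewrite exprn_ile1// ltW. Qed.

(** The Pochhammer symbol [(q;q)_i]. *)
Definition qfac i : R := \prod_(j < i) (1 - q ^+ j.+1).

Lemma qfacS i : qfac i.+1 = qfac i * (1 - q ^+ i.+1).
Proof. by rewrite /qfac big_ord_recr. Qed.

Lemma qfac_itv i : (1 - q) ^+ i <= qfac i <= 1.
Proof.
have I (l : 'I_i) : 1 - q <= 1 - q ^+ l.+1 <= 1.
  apply/andP; split; last by rewrite gerBl.
  by rewrite lerB// -[leRHS]expr1 ler_wiXn2l ?ltW.
apply/andP; split.
  rewrite -[X in _ ^+ X]card_ord -prodr_const; apply: ler_prod => l _.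
  by rewrite subr_ge0 ltW//; have /andP[] := I l.
by apply: prodr_ile1 => l _; have /andP[h ->] := I l; rewrite (le_trans _ h)// subr_ge0 ltW.
Qed.

Lemma qfac_gt0 i : 0 < qfac i.
Proof.
have /andP[+ _] := qfac_itv i; apply: lt_le_trans.
by rewrite exprn_gt0// subr_gt0.
Qed.

(** The Pochhammer symbol [(p;p)_i] in the base [p = 1/q]. *)
Definition pfac i : R := \prod_(l < i) (1 - q ^- l.+1).

Lemma pfacS i : pfac i.+1 = pfac i * (1 - q ^- i.+1).
Proof. by rewrite /pfac big_ord_recr. Qed.

Lemma pfacE i : pfac i = (-1) ^+ i * q ^- 'C(i.+1, 2) * qfac i.
Proof.
elim: i => [|i IH]; first by rewrite /pfac /qfac !big_ord0 bin_small// !expr0 invr1 !mulr1.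
rewrite pfacS IH qfacS [in RHS]binS bin1 exprD [in RHS]exprS.
by field; rewrite !expf_neq0.
Qed.

Lemma jacobi_constE n m :
  jacobi_const q n m = qfac (n + m) / (pfac n * pfac m).
Proof.
rewrite /jacobi_const; congr (_ / _).
  rewrite horner_den_except big_mkcond big_ord_recl/= mul1r /qfac.
  by apply: eq_bigr => j _; rewrite /bump/= exprSr -mulrA divff// mulr1.
rewrite horner_jacobi_num.
by congr (_ * _); apply: eq_bigr => l _; rewrite -invfM -exprSr.
Qed.

(** Passing from base [p] to base [q] extracts the power of [q]; what remains is a Gaussian binomial
    whose factors [qfac i] lie between [(1 - q)^i] and 1. *)
Lemma jacobi_const_norm_itv n m :
  q ^+ ('C(n.+1, 2) + 'C(m.+1, 2)) * (1 - q) ^+ (n + m) <= `|jacobi_const q n m|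
    <= q ^+ ('C(n.+1, 2) + 'C(m.+1, 2)) * (1 - q) ^- (n + m).
Proof.
have q10 i : 0 < (1 - q) ^+ i by rewrite exprn_gt0// subr_gt0.
have f0 := qfac_gt0.
have -> : `|jacobi_const q n m| = q ^+ ('C(n.+1, 2) + 'C(m.+1, 2)) *
    (qfac (n + m) / (qfac n * qfac m)).
  have pN i : `|pfac i| = q ^- 'C(i.+1, 2) * qfac i.
    rewrite pfacE !normrM normrX normrN1 expr1n mul1r.
    by rewrite (gtr0_norm (f0 i)) gtr0_norm// invr_gt0 exprn_gt0.
  rewrite jacobi_constE normrM normfV normrM !pN (gtr0_norm (f0 _)) exprD.
  by field; rewrite !expf_neq0// !(gt_eqF (f0 _)).
have /andP[a1 a2] := qfac_itv n; have /andP[b1 b2] := qfac_itv m.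
have /andP[c1 c2] := qfac_itv (n + m).
have nm0 : 0 < qfac n * qfac m by rewrite mulr_gt0.
apply/andP; split; apply: ler_wpM2l => //.
  rewrite ler_pdivlMr// (le_trans _ c1)// ler_piMr ?(ltW (q10 _))//.
  by rewrite mulr_ile1// ltW.
rewrite ler_pdivrMr// (le_trans c2)// -ler_pdivrMl ?invr_gt0// invrK mulr1 exprD.
by rewrite ler_pM// ltW.
Qed.

(* [sum_(k >= N) q^k / (1 - q^k) = sum_l q^l / (z - q^l)] for [z = q^-N]. *)
Lemma zeta_remainder n m : (m <= n)%N -> (0 < n)%N ->
  series (rem_term q n m) @ \oo -->
    (little_qJacobi q n m).[q ^- (n + m)] * zeta_q1 q -
    (qassoc q n m (q ^- (n + m)) + (little_qJacobi q n m).[q ^- (n + m)] *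
       \sum_(1 <= k < n + m) q ^+ k / (1 - q ^+ k)).
Proof.
move=> mn n0; set N := (n + m)%N; set z := q ^- N.
have N0 : (0 < N)%N by rewrite addn_gt0 n0.
have q1i i : 0 < 1 - q ^+ i.+1 by rewrite subr_gt0 exprn_ilt1// ltW.
rewrite /qassoc little_qJacobiE//; set P := jacobi_poly q n m.
have [r rc _] := remainder_expansion q0 q1 mn n0.
pose w l := q ^+ l / (z - q ^+ l).
have wE l : w l = q ^+ (l + N) / (1 - q ^+ (l + N)).
  rewrite /w /z exprD.
  have h := q1i (l + N.-1)%N; rewrite -addnS prednK// in h.
  rewrite exprD in h; have h0 := negbT (gt_eqF h).
  by field; rewrite h0 expf_neq0.
have [W Wc _] : exists2 s : R, series w @ \oo --> s & `|s| <= (1 - q)^-1 / (1 - q).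
  apply: cvg_series_dominated => // l; rewrite wE.
  rewrite -(prednK N0) addnS.
  have h := q1i (l + N.-1)%N.
  rewrite ger0_norm ?divr_ge0 ?(ltW (q1i _))//.
  rewrite mulrC; apply: ler_pM => //; rewrite ?invr_ge0 ?(ltW h)//.
    rewrite lef_pV2 ?posrE// ?subr_gt0// lerB// -[leRHS]expr1 ler_wiXn2l ?ltW//.
  by rewrite -addnS exprD ler_piMr.
have QE : \big[+%R/0]_(0 <= l <oo) ((P.[z] - P.[q ^+ l]) / (z - q ^+ l) * q ^+ l) = P.[z] * W - r.
  apply: cvg_lim => //.
  have -> : (fun L => \sum_(0 <= l < L) (P.[z] - P.[q ^+ l]) / (z - q ^+ l) * q ^+ l) =
     (fun L => P.[z] * series w L - series (rem_term q n m) L).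
    apply/funext => L; rewrite /series /= mulr_sumr -sumrB; apply: eq_bigr => l _.
    by rewrite /rem_term -/z -/P /w; ring.
  by apply: cvgB => //; apply: cvgMl_tmp.
have zE : zeta_q1 q = \sum_(1 <= k < N) q ^+ k / (1 - q ^+ k) + W.
  apply: cvg_lim => //.
  rewrite -(cvg_shiftn N (fun K => \sum_(1 <= k < K) q ^+ k / (1 - q ^+ k) : R)).
  have -> : [sequence \sum_(1 <= k < L + N) q ^+ k / (1 - q ^+ k)]_L =
      (fun L => \sum_(1 <= k < N) q ^+ k / (1 - q ^+ k) + series w L).
    apply/funext => L; rewrite /= (big_cat_nat N0 (leq_addl _ _))/=; congr (_ + _).
    rewrite -{1}(add0n N) big_addn addnK /series /=.
    by apply: eq_bigr => l _; rewrite wE.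
  by apply: cvgD => //; exact: cvg_cst.
rewrite QE zE (_ : _ - _ = r) //; ring.
Qed.

End ClosedForms.

(** * Integrality *)

(* The sum is the coefficient of ['X^N] in the Lagrange interpolant of [G],
   that is in the remainder of [G] by the monic polynomial [prod_j ('X - x_j)]. *)
Lemma divided_difference_int (F : archiRealFieldType) (G : {poly int}) N (x : nat -> int) :
  injective x ->
  \sum_(i < N.+1) (G.[x i])%:~R / \prod_(j < N.+1 | j != i) ((x i)%:~R - (x j)%:~R : F)
    \is a Num.int.
Proof.
move=> x_inj; pose M : {poly int} := \prod_(j < N.+1) ('X - (x j)%:P).
have Mmonic : M \is monic by exact: monic_prod_XsubC.
have M0 (i : 'I_N.+1) : M.[x i] = 0.
  by rewrite horner_prod (bigD1 i)//= hornerXsubC subrr mul0r.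
pose r := Pdiv.Ring.rmodp G M.
have sr : (size r <= N.+1)%N.
  rewrite -ltnS; apply: leq_trans (Pdiv.Ring.ltn_rmodpN0 G (monic_neq0 Mmonic)) _.
  by rewrite /M -(big_mkord xpredT (fun j => 'X - (x j)%:P)) size_prod_XsubC size_iota subn0.
have rE (i : 'I_N.+1) : G.[x i] = r.[x i].
  rewrite {1}(Pdiv.RingMonic.rdivp_eq Mmonic G) hornerD hornerM M0 mulr0 add0r//.
pose rF : {poly F} := map_poly intr r.
pose w (i : 'I_N.+1) : F := \prod_(j < N.+1 | j != i) ((x i)%:~R - (x j)%:~R).
pose L (i : 'I_N.+1) : {poly F} := \prod_(j < N.+1 | j != i) ('X - ((x j)%:~R)%:P).
have Lw i : (L i).[(x i)%:~R] = w i.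
  by rewrite horner_prod; apply: eq_bigr => j _; rewrite hornerXsubC.
have L0 i j : j != i -> (L j).[(x i)%:~R] = 0.
  by move=> ji; rewrite horner_prod (bigD1 i) 1?eq_sym//= hornerXsubC subrr mul0r.
have sL i : size (L i) = N.+1.
  by rewrite /L -big_enum size_prod_XsubC -cardE cardC1 card_ord.
have LN i : (L i)`_N = 1.
  have : L i \is monic by rewrite /L -big_enum monic_prod_XsubC.
  by rewrite monicE lead_coefE sL => /eqP.
have w0 i : w i != 0.
  apply/prodf_neq0 => j ji; rewrite subr_eq0 eqr_int.
  by apply: contra ji => /eqP/x_inj/val_inj ->.
have E : rF = \sum_(i < N.+1) ((r.[x i])%:~R / w i) *: L i.
  apply/eqP; rewrite -subr_eq0; apply/eqP.
  apply: (@roots_geq_poly_eq0 _ _ [seq (x i)%:~R | i <- iota 0 N.+1]).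
  - apply/allP => _ /mapP[i + ->]; rewrite mem_iota add0n => iN.
    rewrite rootE !hornerE horner_map horner_sum (bigD1 (Ordinal iN))//= hornerZ Lw divfK//.
    by rewrite big1 ?addr0 ?subrr// => j ji; rewrite hornerZ (@L0 (Ordinal iN))// mulr0.
  - by rewrite map_inj_uniq ?iota_uniq// => i j /intr_inj/x_inj.
  - rewrite size_map size_iota (leq_trans (size_polyD _ _))// size_polyN geq_max.
    rewrite (leq_trans (size_poly _ _))//= (leq_trans (size_sum _ _ _))//.
    by apply/bigmax_leqP => i _; rewrite (leq_trans (size_scale_leq _ _))// sL.
have -> : \sum_(i < N.+1) (G.[x i])%:~R / \prod_(j < N.+1 | j != i) ((x i)%:~R - (x j)%:~R : F)
    = rF`_N.
  rewrite E coef_sum; apply: eq_bigr => i _; rewrite coefZ LN mulr1 rE//.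
by rewrite coef_map /= intr_int.
Qed.

(** With [a = N - i] this balances the powers of [q] in the coefficients of [jacobi_poly]. *)
Lemma bin2_shift a i : ('C((a + i).+1, 2) + 'C(i, 2) = 'C(a.+1, 2) + (a + i) * i)%N.
Proof.
elim: i => [|i IH]; first by rewrite addn0 muln0.
by rewrite addnS binS bin1 [X in (_ + X)%N]binS bin1; lia.
Qed.

Section Integrality.
Context {R : realType} (p : nat) (hp : (1 < p)%N) (q : R) (qE : q = p%:R^-1).

Let p0 : (0 : R) < p%:R. Proof. by rewrite ltr0n ltnW. Qed.
Let q0 : 0 < q. Proof. by rewrite qE invr_gt0. Qed.
Let q1 : q < 1. Proof. by rewrite qE invf_lt1// ltr1n. Qed.
Let q_neq0 : q != 0. Proof. by rewrite gt_eqF. Qed.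
Let qN i : q ^- i = p%:R ^+ i. Proof. by rewrite qE exprVn invrK. Qed.
Let qN_int i : q ^- i \is a Num.int.
Proof. by rewrite qN rpredX// natr_int. Qed.

Local Notation pf := (pfac q).
Local Notation qf := (qfac q).

Let pfac_neq0 i : pf i != 0.
Proof.
rewrite pfacE// mulf_neq0 ?(gt_eqF (qfac_gt0 _ _ _))//.
by rewrite mulf_neq0 ?signr_eq0 ?invr_eq0 ?expf_neq0.
Qed.

Let gauss a b := pf (a + b) / (pf a * pf b).

(** Double induction by the q-Pascal rule for the Gaussian binomial in base [p]. *)
Let gauss_int a b : gauss a b \is a Num.int.
Proof.
have pfac0 : pf 0 = 1 by exact: big_ord0.
rewrite /gauss; elim: a b => [b|a IHa].
  by rewrite add0n pfac0 mul1r divff.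
elim=> [|b IHb].
  by rewrite addn0 pfac0 mulr1 divff.
have -> : pf (a.+1 + b.+1) / (pf a.+1 * pf b.+1) =
   pf (a + b.+1) / (pf a * pf b.+1) + q ^- a.+1 * (pf (a.+1 + b) / (pf a.+1 * pf b)).
  have ha := pfac_neq0 a.+1; have hb := pfac_neq0 b.+1.
  rewrite !addSn !addnS !(pfacS _ (a + b).+1) !(pfacS _ a) !(pfacS _ b).
  rewrite !(pfacS _ a) !(pfacS _ b) !mulf_eq0 !negb_or in ha hb.
  have /andP[ha1 ha2] := ha; have /andP[hb1 hb2] := hb.
  have -> : q ^- (a + b).+2 = q ^- a.+1 * q ^- b.+1.
    by rewrite -invfM -exprD addSn addnS.
  move: ha2 hb2; move: (q ^- a.+1) (q ^- b.+1) => u v u1 v1.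
  by field; rewrite ha1 hb1 u1 v1.
by rewrite rpredD// rpredM.
Qed.

Context (n m : nat) (mn : (m <= n)%N) (n0 : (0 < n)%N).
Local Notation N := (n + m)%N.
Local Notation P := (jacobi_poly q n m).
Local Notation C := (jacobi_const q n m).
Let y i := q ^+ i.+1.
Let k := N.+1.
Let z : R := q ^- N.

Let qfacE i : qf i = (-1) ^+ i * q ^+ 'C(i.+1, 2) * pf i.
Proof.
rewrite pfacE// mulrA [_ * (_ * q ^- _)]mulrACA -exprMn mulN1r opprK expr1n mul1r.
by rewrite divff ?mul1r// expf_neq0.
Qed.

Let constE : C = (-1) ^+ N * q ^+ 'C(N.+1, 2) * gauss n m.
Proof. by rewrite jacobi_constE// qfacE mulrA. Qed.

Let pfac_shift j i : \prod_(l < j) (1 - q ^- l * q ^- i.+1) = pf (j + i) / pf i.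
Proof.
elim: j => [|j IH]; first by rewrite big_ord0 add0n divff.
by rewrite big_ord_recr/= IH addSn pfacS mulrAC -invfM -exprD addnS.
Qed.

(** Factors with [j < i] have negative powers of [q] and form [pf i] in reverse order; those with
    [j > i] form [qf (N - i)]. *)
Let den_node (i : 'I_k) : (den_except y i).[q ^- i.+1] = pf i * qf (N - i).
Proof.
rewrite horner_den_except /y big_mkcond/=.
rewrite -(big_mkord xpredT (fun j => if j != i :> nat then 1 - q ^+ j.+1 * q ^- i.+1 else 1)).
rewrite (big_cat_nat (leq0n i) (ltnW (ltn_ord i)))/= [X in _ * X]big_ltn// eqxx mul1r.
congr (_ * _).
  rewrite big_nat_rev/= big_mkord add0n; apply: eq_bigr => l _.
  rewrite ifT; last by have := ltn_ord l; lia.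
  have -> : q ^- i.+1 = q ^- (i - l.+1).+1 * q ^- l.+1.
    by rewrite -invfM -exprD; congr (_ ^- _); have := ltn_ord l; lia.
  by rewrite mulrA mulfV ?expf_neq0// mul1r.
rewrite -{1}(add0n i.+1) big_addn subSS big_mkord; apply: eq_bigr => l _.
rewrite ifT; last by lia.
have -> : (l + i.+1).+1 = (l.+1 + i.+1)%N by lia.
by rewrite exprD mulfK// expf_neq0.
Qed.

(** In this form [q^(N i)] is the only factor that need not be an integer, and [z^i = p^(N i)]
    cancels it. *)
Lemma jacobi_polyE (i : 'I_k) : P`_i =
  (-1) ^+ i * q ^+ (N * i) * q ^- 'C(i, 2) * gauss n i * gauss m i * gauss (N - i) i.
Proof.
have iN : (i <= N)%N by rewrite -ltnS.
rewrite coef_poly ltn_ord inord_val horner_jacobi_num !pfac_shift den_node.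
rewrite constE qfacE /gauss (subnK iN).
have e : q ^+ 'C(N.+1, 2) = q ^+ 'C((N - i).+1, 2) * q ^+ (N * i) / q ^+ 'C(i, 2).
  have := bin2_shift (N - i) i; rewrite subnK// -exprD => <-.
  by rewrite exprD mulfK// expf_neq0.
have s : (-1) ^+ N = (-1) ^+ (N - i) * (-1) ^+ i :> R by rewrite -exprD subnK.
have si : (-1) ^+ (N - i) != 0 :> R by rewrite signr_eq0.
have := pfac_neq0 n; have := pfac_neq0 m; have := pfac_neq0 i; have := pfac_neq0 (N - i).
rewrite e s; move: si; move: ((-1) ^+ (N - i)) ((-1) ^+ i) => sa sb sa0 p1 p2 p3 p4.
have h1 : q ^+ 'C((N - i).+1, 2) != 0 by rewrite expf_neq0.
have h2 : q ^+ 'C(i, 2) != 0 by rewrite expf_neq0.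
by field; rewrite h1 h2 p1 p2 p3 p4 sa0.
Qed.

Let coef_int (i : 'I_k) : P`_i * z ^+ i \is a Num.int.
Proof.
have -> : P`_i * z ^+ i = (-1) ^+ i * q ^- 'C(i, 2) * gauss n i * gauss m i * gauss (N - i) i.
  rewrite jacobi_polyE /z exprVn -exprM.
  have h : q ^+ (N * i) != 0 by rewrite expf_neq0.
  by rewrite mulrC !mulrA (mulrC _ ((-1) ^+ i)) mulfVK.
by do 3!(apply: rpredM; last exact: gauss_int); rewrite rpredM// rpred_sign.
Qed.

Let horner_jacobi t : P.[t] = \sum_(i < k) P`_i * t ^+ i.
Proof. by apply: horner_coef_wide; exact: size_poly. Qed.

Lemma jacobi_horner_node_int : P.[z] \is a Num.int.
Proof. by rewrite horner_jacobi rpred_sum. Qed.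

(* [q^-l P(q^-l)] is a constant times a divided difference of an integer
   polynomial at the nodes [p^(i+1)]. *)
Lemma jacobi_horner_int l : (0 < l <= N)%N -> P.[q ^- l] \is a Num.int.
Proof.
move=> /andP[l0 lN].
pose x i := ((p ^ i.+1)%N)%:Z.
have x_inj : injective x.
  by move=> i j /eqP; rewrite eqz_nat eqn_exp2l// eqSS => /eqP.
have xE i : (x i)%:~R = q ^- i.+1 :> R by rewrite -pmulrn natrX qN.
(* An integral model of [jacobi_num]. The factor ['X^(l.-1)] accounts for the powers of [q^-l],
   because [p^(l(i+1))] is also the [l]-th power of the node [p^(i+1)]. *)
pose G : {poly int} := \prod_(a < n) (1 - ((p ^ a)%N)%:Z *: 'X) *
   \prod_(a < m) (1 - ((p ^ a)%N)%:Z *: 'X) * 'X^(l.-1).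
have GE i : (G.[x i])%:~R = (jacobi_num q n m).[q ^- i.+1] * (q ^- i.+1) ^+ l.-1.
  rewrite horner_jacobi_num /G !hornerM hornerXn !rmorphM/= rmorphXn/= xE.
  have pE j : ((\prod_(a < j) (1 - (p ^ a)%N%:Z *: 'X)).[x i])%:~R =
     \prod_(a < j) (1 - q ^- a * q ^- i.+1) :> R.
    rewrite horner_prod rmorph_prod; apply: eq_bigr => a _.
    by rewrite !hornerE rmorphB/= rmorphM/= xE -pmulrn natrX -qN.
  by rewrite !pE.
have := divided_difference_int R G N x_inj; set DD := \sum_(i < _) _ => DDint.
suff -> : P.[q ^- l] = gauss n m * q ^- (N.+1 - l) * DD by apply: rpredM => //; apply: rpredM.
have ql : q ^- l != 0 by rewrite invr_eq0 expf_neq0.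
have prodx : \prod_(j < k) q ^- j.+1 = q ^- 'C(N.+2, 2).
  rewrite /k; elim: N => [|j IH]; first by rewrite big_ord_recl big_ord0 mulr1.
  by rewrite big_ord_recr/= IH [in RHS]binS bin1 -invfM -exprD.
apply: (mulfI ql); rewrite /DD mulr_sumr mulr_sumr horner_jacobi mulr_sumr.
apply: eq_bigr => i _.
have xi : q ^- i.+1 != 0 by rewrite invr_eq0 expf_neq0.
(* Each factor [1 - y j * x i] equals [- (x i - x j) / x j], and the product of all nodes is
   [q^-C(N+2, 2)]; the node [x i] itself is left over on the right. *)
have dE : (den_except y i).[q ^- i.+1] * ((-1) ^+ N * q ^- 'C(N.+2, 2)) =
    q ^- i.+1 * \prod_(j < k | j != i) ((x i)%:~R - (x j)%:~R : R).
  have E (a b c d : R) : a * (b * (c * d)) = c * (b * (a * d)) by ring.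
  rewrite -prodx (bigD1 i)//= E; congr (_ * _).
  rewrite horner_den_except.
  have -> : (-1) ^+ N = \prod_(j < k | j != i) (-1) :> R.
    by rewrite prodr_const cardC1 card_ord.
  rewrite -!big_split/=; apply: eq_bigr => j _; rewrite !xE /y.
  have h : q ^+ j.+1 != 0 by rewrite expf_neq0.
  by move: h; move: (q ^+ j.+1) (q ^- i.+1) => u v u0; field.
have y_inj : injective y.
  by move=> a b /(ieexprIn q0 _) /= h; apply: succn_inj; apply: h; rewrite lt_eqF.
have y0 a : y a != 0 by rewrite expf_neq0.
have d0 := den_except_node_neq0 y0 y_inj i.
have w0 : \prod_(j < k | j != i) ((x i)%:~R - (x j)%:~R : R) != 0.
  by apply/prodf_neq0 => j ji; rewrite subr_eq0 eqr_int; apply: contra ji => /eqP/x_inj/val_inj ->.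
rewrite GE coef_poly ltn_ord inord_val constE.
have e1 : q ^- l * (q ^- l) ^+ i = q ^- i.+1 * (q ^- i.+1) ^+ l.-1.
  by rewrite -!exprS prednK// !qN -!exprM mulnC.
have e2 : q ^- l * q ^- (N.+1 - l) = q ^- N.+1.
  by rewrite -invfM -exprD subnKC// leqW.
have e3 : q ^- N.+1 = q ^+ 'C(N.+1, 2) * q ^- 'C(N.+2, 2).
  by rewrite (binS N.+1 1) bin1 exprD invfM mulrA divff ?mul1r// expf_neq0.
have e4 : q ^- i.+1 = (den_except y i).[q ^- i.+1] * ((-1) ^+ N * q ^- 'C(N.+2, 2))
    / \prod_(j < k | j != i) ((x i)%:~R - (x j)%:~R).
  by rewrite dE mulfK.
have s2 : (-1) ^+ N * (-1) ^+ N = 1 :> R by rewrite -exprMn mulN1r opprK expr1n.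
move: d0 w0 e1 e2 e3 e4 s2; rewrite /y.
move: (den_except _ i).[_] (\prod_(j < k | j != i) _) (jacobi_num q n m).[_] => D w f.
move: (q ^- N.+1) (q ^- (_ - l)) (q ^+ 'C(_, _)) (q ^- 'C(_, _)) => e e' t X.
move: (q ^- l) (q ^- i.+1) ((-1) ^+ N) (gauss n m) => u xx s g D0 w0.
move: (xx ^+ _) (u ^+ _) => a b e1 e2 e3 e4 s2.
transitivity (s * t * g * f * (u * b) / D); first by field.
rewrite e1 e4; transitivity ((s * s) * (t * X) * (g * f * a / w)); first by field; rewrite w0.
by rewrite s2 -e3 -e2; ring.
Qed.

Let N0 : (0 < N)%N. Proof. by rewrite addn_gt0 n0. Qed.

(** The difference quotient of [X^i] is a sum of [z^(i-1-b) (q^l)^b]; with the weight [q^l] each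
    term is geometric in [l] with ratio [q^(b+1)]. *)
Lemma qassocE : qassoc q n m z =
  \sum_(i < k) P`_i * \sum_(b < i) z ^+ (i.-1 - b) / (1 - q ^+ b.+1).
Proof.
rewrite /qassoc little_qJacobiE//; apply: cvg_lim => //.
have zq l : z - q ^+ l != 0.
  rewrite subr_eq0 gt_eqF// (@le_lt_trans _ _ 1) ?exprn_ile1 ?ltW//.
  by rewrite invf_gt1 ?exprn_gt0// exprn_ilt1 ?ltW// -lt0n.
have -> : (fun L => \sum_(0 <= l < L) (P.[z] - P.[q ^+ l]) / (z - q ^+ l) * q ^+ l) =
   series (fun l => \sum_(i < k) \sum_(b < i) P`_i * z ^+ (i.-1 - b) * (q ^+ b.+1) ^+ l).
  apply/funext => L; apply: eq_bigr => l _.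
  rewrite !horner_jacobi -sumrB !mulr_suml; apply: eq_bigr => i _.
  rewrite -mulrBr subrXX.
  have h := zq l; move: (z - q ^+ l) h => d d0.
  set S := \sum_(_ < _) _.
  transitivity (P`_i * S * q ^+ l); first by field.
  rewrite /S mulr_sumr mulr_suml; apply: eq_bigr => b _.
  by rewrite -!mulrA -exprSr -!exprM mulnC.
apply: cvg_series_sum => i; rewrite mulr_sumr.
apply: cvg_series_sum => b; rewrite mulrA.
apply: (@cvg_geometric_series R (P`_i * z ^+ (i.-1 - b)) (q ^+ b.+1)).
by rewrite ger0_norm ?exprn_ilt1 ?exprn_ge0// ltW.
Qed.

(** The power [z^(i-1-b)] alone does not clear the coefficient [P_i]. With [Y = p^(b+1)], write
    [1/(1 - q^(b+1)) = Y^N/(Y - 1) - sum_(1<=l<N) Y^l]. The first part restores the full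
    [z^i = z^(i-1-b) Y^N]; the second regroups into differences of values of [P], as
    [z - p^l = p^l (p^(N-l) - 1)]. *)
Lemma qassoc_split : qassoc q n m z =
  \sum_(i < k) P`_i * z ^+ i * (\sum_(b < i) (p%:R ^+ b.+1 - 1)^-1) -
  \sum_(1 <= l < N) (P.[z] - P.[q ^- l]) / (p%:R ^+ (N - l) - 1).
Proof.
have zE : z = p%:R ^+ N by rewrite /z qN.
have p1 b : (p%:R : R) ^+ b.+1 - 1 != 0.
  by rewrite subr_eq0 gt_eqF// exprn_egt1// ltr1n.
have geom (Y : R) : \sum_(1 <= l < N) Y ^+ l * (Y - 1) = Y ^+ N - Y.
  rewrite -[X in _ = _ - X]expr1 -(telescope_sumr _ N0).
  by apply: eq_bigr => l _; rewrite exprSr mulrBr mulr1.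
rewrite qassocE.
transitivity (\sum_(i < k) P`_i * \sum_(b < i) (z ^+ i / (p%:R ^+ b.+1 - 1) -
    z ^+ (i.-1 - b) * \sum_(1 <= l < N) (p%:R ^+ b.+1) ^+ l)).
  apply: eq_bigr => i _; congr (_ * _); apply: eq_bigr => b _.
  have -> : z ^+ i = z ^+ (i.-1 - b) * (p%:R ^+ b.+1) ^+ N.
    rewrite zE -!exprM (mulnC b.+1) !exprM -exprD; congr (_ ^+ _).
    by have := ltn_ord b; lia.
  have -> : q ^+ b.+1 = (p%:R ^+ b.+1)^-1 by rewrite qE exprVn.
  have Y1 := p1 b; have Y0 : (p%:R : R) ^+ b.+1 != 0 by rewrite expf_neq0// gt_eqF.
  have := geom (p%:R ^+ b.+1); rewrite -mulr_suml.
  move: Y1 Y0; move: (p%:R ^+ b.+1) => Y Y1 Y0.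
  move: (\sum_(1 <= l < N) _) => S /(congr1 (fun t => t / (Y - 1))); rewrite mulfK// => ->.
  by field; rewrite Y1 Y0.
have zl l : (0 < l < N)%N -> z - p%:R ^+ l = p%:R ^+ l * (p%:R ^+ (N - l) - 1).
  by move=> /andP[_ lN]; rewrite mulrBr mulr1 -exprD subnKC ?zE// ltnW.
have -> : \sum_(1 <= l < N) (P.[z] - P.[q ^- l]) / (p%:R ^+ (N - l) - 1) =
   \sum_(i < k) \sum_(1 <= l < N) P`_i * \sum_(b < i) z ^+ (i.-1 - b) * (p%:R ^+ b.+1) ^+ l.
  rewrite exchange_big/=; apply: eq_big_nat => l lN.
  rewrite !horner_jacobi -sumrB mulr_suml; apply: eq_bigr => i _.
  rewrite -mulrBr -mulrA; congr (_ * _).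
  have d0 : (p%:R : R) ^+ (N - l) - 1 != 0.
    by have -> : (N - l)%N = (N - l).-1.+1 by lia.
  apply: (mulIf d0); rewrite divfK//.
  have pl : (p%:R : R) ^+ l != 0 by rewrite expf_neq0// gt_eqF.
  rewrite subrXX qN zl// -mulrA mulrCA [RHS]mulrC; congr (_ * _).
  rewrite mulr_sumr; apply: eq_bigr => b _.
  by rewrite mulrCA -!exprM mulSn exprD mulnC.
rewrite -sumrB; apply: eq_bigr => i _.
rewrite -[X in _ = _ - X]mulr_sumr -mulrA -mulrBr; congr (_ * _).
rewrite sumrB mulr_sumr; congr (_ - _).
rewrite exchange_big/=; apply: eq_bigr => b _.
by rewrite mulr_sumr.
Qed.

Lemma qassoc_combination_int (d : R) :
  (forall j, (0 < j <= N)%N -> d / (p%:R ^+ j - 1) \is a Num.int) ->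
  d * (qassoc q n m z + P.[z] * \sum_(1 <= j < N) (p%:R ^+ j - 1)^-1) \is a Num.int.
Proof.
move=> dj; rewrite mulrDr rpredD//.
  rewrite qassoc_split mulrBr !mulr_sumr rpredB//.
    apply: rpred_sum => i _; rewrite mulrCA rpredM// mulr_sumr rpred_sum// => b _.
    by apply: dj; rewrite /= (leq_trans (ltn_ord b))// -ltnS.
  rewrite big_nat; apply: rpred_sum => l lN.
  rewrite mulrCA; apply: rpredM; last by apply: dj; lia.
  by apply: rpredB; [exact: jacobi_horner_node_int | apply: jacobi_horner_int; lia].
rewrite mulrCA; apply: rpredM; first exact: jacobi_horner_node_int.
rewrite mulr_sumr big_nat; by apply: rpred_sum => l lN; apply: dj; lia.
Qed.

End Integrality.

(** * The linear form *)

(** For [m = n - 1]: the two binomials come from the constant, and the product [N (n+1)] from the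
    first nonzero moment. *)
Lemma exponent_identity n : (0 < n)%N ->
  (3 * n ^ 2 + n - 1 = 'C(n.+1, 2) + 'C(n, 2) + (n + (n - 1)) * n.+1)%N.
Proof.
move=> n0; have := mul_bin_left n 1; rewrite bin1 => h.
rewrite binS bin1 -mulnn; move: h; move: ('C(n, 2)) => c h.
nia.
Qed.

Section Asymptotics.
Context {R : realType} (p : nat) (hp : (1 < p)%N).
Local Notation q := (p%:R^-1 : R).
Local Notation zeta := (zeta_q1 q).

Let p0 : (0 : R) < p%:R. Proof. by rewrite ltr0n ltnW. Qed.
Let q0 : 0 < q. Proof. by rewrite invr_gt0. Qed.
Let q1 : q < 1. Proof. by rewrite invf_lt1// ltr1n. Qed.
Let lnp_gt0 : 0 < ln (p%:R : R). Proof. by rewrite ln_gt0// ltr1n. Qed.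

Let degE n : (0 < n)%N -> (2 * n - 1 = n + (n - 1))%N. Proof. by lia. Qed.
Let nodeE N : (p%:R : R) ^+ N = q ^- N. Proof. by rewrite exprVn invrK. Qed.

Lemma alpha_int n : (0 < n)%N -> alpha_ R p n \is a Num.int.
Proof.
move=> n0; rewrite /alpha_ degE// nodeE little_qJacobiE ?leq_subr//.
by apply: (qassoc_combination_int hp); rewrite ?leq_subr// => j jN; exact: dval_div_int.
Qed.

Lemma beta_int n : (0 < n)%N -> beta_ R p n \is a Num.int.
Proof.
move=> n0; rewrite /beta_ degE// nodeE little_qJacobiE ?leq_subr//.
apply: rpredM; first exact: intr_int.
by apply: (jacobi_horner_node_int hp); rewrite ?leq_subr.
Qed.

Lemma linear_form_bounds n : (0 < n)%N ->
  dval R p (2 * n - 1) * ((1 - q) ^+ (4 * n) / p%:R ^+ (3 * n ^ 2 + n - 1))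
    <= `|beta_ R p n * zeta - alpha_ R p n| <=
  dval R p (2 * n - 1) * ((1 - q) ^- (4 * n) / p%:R ^+ (3 * n ^ 2 + n - 1)).
Proof.
move=> n0; have mn : (n - 1 <= n)%N by rewrite leq_subr.
(* Exponents of [1 - q] collected from the constant and the remainder, with [N = 2n - 1]: [N + N]
   below and [N + (N + 2) = 4n] above. *)
have N4 : (n + (n - 1) + (n + (n - 1)) <= 4 * n /\ n + (n - 1) + (n + (n - 1)).+2 <= 4 * n)%N by lia.
have u0 : 0 < 1 - q by rewrite subr_gt0.
have u1 : 1 - q <= 1 by rewrite gerBl ltW.
have [r rc rB] := remainder_bounds q0 q1 mn n0.
have E : beta_ R p n * zeta - alpha_ R p n = dval R p (2 * n - 1) * r.
  rewrite /beta_ /alpha_ -mulrA -mulrBr; congr (_ * _).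
  rewrite degE// nodeE.
  have -> : \sum_(1 <= k < n + (n - 1)) (p%:R ^+ k - 1)^-1 =
     \sum_(1 <= k < n + (n - 1)) q ^+ k / (1 - q ^+ k).
    apply: eq_big_nat => k /andP[k0 _]; rewrite exprVn.
    have : (p%:R : R) ^+ k - 1 != 0.
      by rewrite subr_eq0 gt_eqF// exprn_egt1// ?ltr1n// -lt0n.
    have : (p%:R : R) ^+ k != 0 by rewrite expf_neq0// gt_eqF.
    by move: (p%:R ^+ k) => Y Y0 Y1; field; rewrite Y0 Y1.
  by apply: cvg_unique (zeta_remainder q0 q1 mn n0) rc; exact: Rhausdorff.
have d0 := dval_gt0 (R := R) hp (2 * n - 1).
rewrite E normrM (gtr0_norm d0) !ler_pM2l//.
have q10 i : 0 < (1 - q) ^+ i by rewrite exprn_gt0// subr_gt0.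
have [/andP[Clo Chi] /andP[rlo rhi]] := (jacobi_const_norm_itv q0 q1 n (n - 1), rB).
set N := (n + (n - 1))%N in Clo Chi rlo rhi.
have pE : (p%:R ^+ (3 * n ^ 2 + n - 1))^-1 =
    q ^+ ('C(n.+1, 2) + 'C((n - 1).+1, 2)) * q ^+ (N * n.+1).
  rewrite -exprD exprVn; congr (_ ^- _); rewrite /N.
  have -> : (n - 1).+1 = n by rewrite subn1 prednK.
  exact: exponent_identity.
have qX0 i : 0 <= q ^+ i by rewrite exprn_ge0// ltW.
have shuffle (a b A V : R) : a * A * (V * b) = A * V * (a * b) by ring.
rewrite pE; apply/andP; split.
  apply: le_trans rlo; apply: le_trans (ler_wpM2r _ Clo).
    rewrite shuffle -!exprD; apply: ler_wpM2r => //.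
    by rewrite ler_wiXn2l// ?(ltW u0)//; case: N4.
  by rewrite mulr_ge0// ltW.
apply: le_trans rhi _; apply: le_trans (ler_wpM2r _ Chi) _.
  by rewrite mulr_ge0// invr_ge0 ltW.
rewrite shuffle -invfM -!exprD; apply: ler_wpM2r => //.
rewrite lef_pV2 ?posrE//.
by rewrite ler_wiXn2l// ?(ltW u0)//; case: N4.
Qed.

Lemma linear_form_gt0 n : (0 < n)%N -> 0 < `|beta_ R p n * zeta - alpha_ R p n|.
Proof.
move=> n0; have /andP[+ _] := linear_form_bounds n0; apply: lt_le_trans.
by rewrite mulr_gt0 ?dval_gt0// divr_gt0 ?exprn_gt0// subr_gt0.
Qed.

Lemma ln_linear_form_bounds n : (0 < n)%N ->
  `|ln `|beta_ R p n * zeta - alpha_ R p n| -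
    (ln (dval R p (2 * n - 1)) - (3 * n ^ 2 + n - 1)%:R * ln p%:R)|
  <= - (4 * n)%:R * ln (1 - q).
Proof.
move=> n0; have A0 := linear_form_gt0 n0.
have d0 := dval_gt0 (R := R) hp (2 * n - 1).
have u0 : 0 < 1 - q by rewrite subr_gt0.
have ln3 (a b c : R) : 0 < a -> 0 < b -> 0 < c ->
    ln (a * (b / c)) = ln a + (ln b - ln c) /\ 0 < a * (b / c).
  move=> a0 b0 c0; have bc0 : 0 < b / c by rewrite divr_gt0.
  by split; [rewrite lnM// ln_div|rewrite mulr_gt0].
have uX : 0 < (1 - q) ^+ (4 * n) by rewrite exprn_gt0.
have pX : 0 < (p%:R : R) ^+ (3 * n ^ 2 + n - 1) by rewrite exprn_gt0.
have uV : 0 < (1 - q) ^- (4 * n) by rewrite invr_gt0.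
have [E1 P1] := ln3 _ _ _ d0 uX pX; have [E2 P2] := ln3 _ _ _ d0 uV pX.
have /andP[] := linear_form_bounds n0.
rewrite -ler_ln// E1 => lo; rewrite -ler_ln// E2 => hi.
move: lo hi; rewrite lnV// !lnXn// -!(mulr_natl (ln _)) mulNr.
set a := ln `|_|; set b := ln (dval _ _ _); set c := _ * ln p%:R; set e := _ * ln (1 - q).
by move=> lo hi; rewrite ler_norml; apply/andP; split; lra.
Qed.

(** Since [(2n - 1)/n = 2 - 1/n] tends to 2, the coefficient 3 for [d_N] becomes 12. *)
Lemma ln_dval_odd_cvg :
  (fun n => ln (dval R p (2 * n.+1 - 1)) / n.+1%:R ^+ 2) @ \oo -->
    12 * ln p%:R / (pi : R) ^+ 2.
Proof.
have -> : (fun n => ln (dval R p (2 * n.+1 - 1)) / n.+1%:R ^+ 2) =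
   (fun n => ln (dval R p (2 * n.+1 - 1)) / (2 * n.+1 - 1)%:R ^+ 2 *
      ((2 - harmonic n) * (2 - harmonic n)) : R).
  apply/funext => n; rewrite /= natrB// natrM.
  have n0 : n.+1%:R != 0 :> R by rewrite pnatr_eq0.
  have n1 : 2 * n.+1%:R - 1 != 0 :> R.
    by rewrite -natrM -(natrB _ (n := 1))// pnatr_eq0; lia.
  by move: n0 n1; move: (n.+1%:R) => x x0 x1; field; rewrite x0 x1.
have -> : 12 * ln p%:R / (pi : R) ^+ 2 = 3 * ln p%:R / (pi : R) ^+ 2 * ((2 - 0) * (2 - 0)).
  by rewrite subr0; ring.
have hc : (fun n => 2 - harmonic n) @ \oo --> (2 - 0 : R).
  by apply: cvgB; [exact: cvg_cst|exact: cvg_harmonic].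
apply: cvgM; last exact: cvgM.
have : (fun n => 2 * n.+1 - 1)%N @ \oo --> \oo.
  apply/cvgnyPge => M; near=> n.
  by apply: (@leq_trans n); [near: n; exact: nbhs_infty_ge|lia].
by move=> oo; exact: (cvg_comp _ _ oo (ln_dval_cvg hp)).
Unshelve. all: by end_near. Qed.

Let rate : R := - (3 * (pi ^+ 2 - 4) / pi ^+ 2).

Lemma ln_linear_form_cvg :
  (fun n => ln `|beta_ R p n.+1 * zeta - alpha_ R p n.+1| / n.+1%:R ^+ 2) @ \oo -->
    rate * ln p%:R.
Proof.
pose h : nat -> R := harmonic.
have h0 : h @ \oo --> 0 by exact: cvg_harmonic.
pose K := - 4 * ln (1 - q).
(* With [h n = 1/(n+1)], the bracket is the exponent [3 x^2 + x - 1] divided by [x^2] at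
   [x = n + 1]. *)
pose v n := ln (dval R p (2 * n.+1 - 1)) / n.+1%:R ^+ 2 - (3 + h n - h n * h n) * ln p%:R.
have vc : v @ \oo --> rate * ln p%:R.
  have -> : rate * ln p%:R = 12 * ln p%:R / pi ^+ 2 - (3 + 0 - 0 * 0) * ln p%:R.
    have : pi != 0 :> R by rewrite gt_eqF// pi_gt0.
    by rewrite /rate; move: (pi : R) => P P0; field.
  apply: cvgB; first exact: ln_dval_odd_cvg.
  apply: cvgMr_tmp; apply: cvgB; last exact: cvgM.
  by apply: cvgD => //; exact: cvg_cst.
have Kh : (fun n => K * h n) @ \oo --> (0 : R).
  by rewrite -(mulr0 K); apply: cvgMl_tmp.
apply: (@squeeze_cvgr _ _ _ _ (fun n => v n - K * h n) (fun n => v n + K * h n)).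
- near=> n; have := ln_linear_form_bounds (ltn0Sn n).
  rewrite natrB; last by lia.
  rewrite natrD natrM natrX natrM.
  have n0 : 0 < n.+1%:R :> R by rewrite ltr0n.
  have n2 : 0 < n.+1%:R ^+ 2 :> R by rewrite exprn_gt0.
  rewrite ler_pdivlMr// ler_pdivrMr//.
  have Kx : K * h n * n.+1%:R ^+ 2 = K * n.+1%:R.
    by rewrite /h /harmonic /=; move: n0; move: (n.+1%:R) => x x0; field; rewrite gt_eqF.
  have vx : v n * n.+1%:R ^+ 2 = ln (dval R p (2 * n.+1 - 1)) -
      (3 * n.+1%:R ^+ 2 + n.+1%:R - 1) * ln p%:R.
    by rewrite /v /h /harmonic /=; move: n0; move: (n.+1%:R) => x x0; field; rewrite gt_eqF.
  rewrite (mulrBl _ (v n)) (mulrDl (v n)) vx Kx /K ler_norml.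
  move=> /andP[lo hi]; apply/andP; split; lra.
- by rewrite -[X in _ --> X]subr0; exact: cvgB.
- by rewrite -[X in _ --> X]addr0; exact: cvgD.
Unshelve. all: by end_near. Qed.

Lemma linear_form_root_cvg :
  (fun n : nat => `|beta_ R p n * zeta - alpha_ R p n| `^ ((n ^ 2)%N%:R)^-1) @ \oo -->
    p%:R `^ rate.
Proof.
have rootE (x a : R) : 0 < x -> x `^ a = expR (a * ln x).
  by move=> x0; rewrite -ln_powR lnK// posrE powR_gt0.
(* The shift discards [n = 0], for which positivity of the linear form has not been established. *)
rewrite -(cvg_shiftS (fun n : nat =>
  `|beta_ R p n * zeta - alpha_ R p n| `^ ((n ^ 2)%N%:R)^-1)) rootE//.
have -> : [sequence `|beta_ R p n.+1 * zeta - alpha_ R p n.+1| `^ ((n.+1 ^ 2)%N%:R)^-1]_n =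
    expR \o (fun n => ln `|beta_ R p n.+1 * zeta - alpha_ R p n.+1| / n.+1%:R ^+ 2).
  by apply/funext => n; rewrite /= rootE ?linear_form_gt0// natrX mulrC.
by apply: continuous_cvg; [exact: continuous_expR|exact: ln_linear_form_cvg].
Qed.

Lemma root_limit_lt1 : (p%:R : R) `^ rate < 1.
Proof.
rewrite -(@ltr_ln R) ?posrE ?powR_gt0// ln_powR ln1 nmulr_rlt0// oppr_lt0.
by rewrite divr_gt0 ?exprn_gt0 ?pi_gt0// mulr_gt0// subr_gt0; have := @pi_gt2 R; nra.
Qed.

End Asymptotics.

Unset Implicit Arguments.

Theorem theorem1p1 (R : realType) (p : nat) (hp : (1 < p)%N) :
  (forall n : nat, (1 <= n)%N ->
     [/\ alpha_ R p n \is a Num.int,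
         beta_ R p n \is a Num.int
       & beta_ R p n * zeta_q1 (p%:R^-1 : R) - alpha_ R p n != 0]) /\
  (exists L : R,
     [/\ (fun n : nat =>
            `|beta_ R p n * zeta_q1 (p%:R^-1 : R) - alpha_ R p n|
              `^ ((n ^ 2)%N%:R)^-1) @ \oo --> L,
         L <= p%:R `^ (- (3 * (pi ^+ 2 - 4) / pi ^+ 2))
       & (p%:R : R) `^ (- (3 * (pi ^+ 2 - 4) / pi ^+ 2)) < 1]).
Proof.
split=> [n n0|].
  split; [exact: alpha_int|exact: beta_int|].
  by rewrite -normr_gt0 linear_form_gt0.
(* The limit is the stated bound itself, so the inequality holds by reflexivity. *)
exists (p%:R `^ (- (3 * (pi ^+ 2 - 4) / pi ^+ 2))).
split=> //; [exact: linear_form_root_cvg|exact: root_limit_lt1].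
Qed.
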